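(* Let $\gamma$ and $\psi$ satisfy assumptions (a.1)–(a.5) below. For $f\in C_0^\infty(\mathbb{R})$ define \[ T_1 f(x)=\lim_{\varepsilon\to0^+}\int_\varepsilon^1 e^{i\gamma(t)}f(x-t)\,\frac{dt}{t}. \] Then $T_1$ is of weak type $(1,1)$: there is a constant $A$ such that for all $f\in C_0^\infty(\mathbb{R})$ and all $\alpha>0$, \[ |\{x\in\mathbb{R}:|T_1f(x)|>\alpha\}|\le \frac{A}{\alpha}\|f\|_{L^1(\mathbb{R})}. \]
   Context: Standing assumptions: $\gamma\in C^3((0,1])$ is real-valued with $\lim_{t\to0^+}|\gamma(t)|=\infty$, and $\psi\in C^2([0,1])$ is positive on $(0,1]$ with $\lim_{t\to0^+}\psi(t)=0$. There are constants $t_0,s_0,C>0$ such that: (a.1) $\gamma,\psi,\gamma',\gamma'',\psi'$ are all monotone; moreover $\gamma'(t)>0$ and $\gamma'$ is decreasing on $(0,1]$. (Hence $\gamma'$ has an inverse $\gamma'^{-1}(s)$ for $s\ge\gamma'(1)$.) (a.2) For $0<t<t_0$: $\left|\frac{\psi'(t)}{\psi(t)}\right|\le\frac12\left|\frac{\gamma'''(t)}{\gamma''(t)}\right|$. (a.3) For $s>s_0$: $|\gamma''(\gamma'^{-1}(2s))|\le C|\gamma''(\gamma'^{-1}(s))|$. (a.4) There exist $\epsilon>0$ and $A>1+\epsilon$ such that $\gamma'(t)\ge A\gamma'((1+\epsilon)t)$ for $0<t<t_0$. (a.5) There exists $1/2<\lambda<1$ such that $|\gamma''(t)|\le C\gamma'(t)^{2\lambda}$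 for $0<t<t_0$. *)

(* Defs.v *)
From Stdlib Require Import Reals.
Open Scope R_scope.

Definition monotone_on (D : R -> Prop) (g : R -> R) : Prop :=
  (forall x y, D x -> D y -> x <= y -> g x <= g y) \/
  (forall x y, D x -> D y -> x <= y -> g y <= g x).

Definition in_0_1 (t : R) : Prop := 0 < t <= 1.
Definition in_cl_0_1 (t : R) : Prop := 0 <= t <= 1.

Definition cont_within (D : R -> Prop) (g : R -> R) (x : R) : Prop :=
  forall eta, 0 < eta -> exists delta, 0 < delta /\
    forall y, D y -> Rabs (y - x) < delta -> Rabs (g y - g x) < eta.

Definition smooth (g : R -> R) : Prop :=
  exists D : nat -> R -> R, D O = g /\
    forall n x, derivable_pt_lim (D n) x (D (S n) x).

Definition riemann_int_is (h : R -> R) (a b I : R) : Prop :=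
  exists pr : Riemann_integrable h a b, RiemannInt pr = I.

(* Truncated operator, real and imaginary parts, for f = u + i v:
   int_eps^1 e^{i gamma(t)} f(x-t) dt/t *)
Definition T1_re (gamma u v : R -> R) (x : R) : R -> R :=
  fun t => (cos (gamma t) * u (x - t) - sin (gamma t) * v (x - t)) / t.
Definition T1_im (gamma u v : R -> R) (x : R) : R -> R :=
  fun t => (sin (gamma t) * u (x - t) + cos (gamma t) * v (x - t)) / t.

Definition T1_limit (gamma u v : R -> R) (x Lr Li : R) : Prop :=
  forall eta, 0 < eta -> exists delta, 0 < delta /\
    forall eps, 0 < eps < delta -> exists Ir Ii,
      riemann_int_is (T1_re gamma u v x) eps 1 Ir /\
      riemann_int_is (T1_im gamma u v x) eps 1 Ii /\
      sqrt ((Ir - Lr) ^ 2 + (Ii - Li) ^ 2) < eta.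

Definition outer_measure_le (E : R -> Prop) (c : R) : Prop :=
  forall eta, 0 < eta -> exists a b : nat -> R,
    (forall n, a n <= b n) /\
    (forall x, E x -> exists n, a n < x < b n) /\
    (forall N, sum_f_R0 (fun n => b n - a n) N <= c + eta).

(* Main.v *)
Require Import Defs.
From Stdlib Require Import Reals ZArith Lra Lia List Classical.
From Coquelicot Require Import Coquelicot.
Open Scope R_scope.

(** Replace a real component of f by point masses c_n on a fine grid y_n, and let
    k = e^{i gamma(t)}/t.  A Calderon-Zygmund stopping time at height alpha gives each mass
    a scale l_n: off the union of the doubled stopping intervals, of total length
    O(|f|_1/alpha), every mass acts only through k restricted to t > l_n, and the masses
    with l_n <= r in an interval I add up to O(alpha (|I| + r)).  By [van_der_corput], the
    correlation of two truncations of k, centred at distance z, is O(1/max(l,l')) and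
    O(z^(th-1)) for some th > 0: convexity of gamma' and (a.4) bound the derivative
    gamma'(t) - gamma'(t+z) of the phase from below.  Summing over all pairs, the squared
    L^2 norm of the truncated sum is O(alpha |f|_1), and Chebyshev's inequality concludes;
    neither the cancellation of the bad part nor a Fourier transform is involved. *)

(** The gain of z^th makes the correlation integrable at z = 0. A mass of scale l then sees its
    neighbours within distance l at cost 1/l and the others at cost z^(th-1), in both cases against
    density O(alpha), and the total is O(alpha) uniformly in l. Point masses reduce the stopping
    time and the L^2 bound to finite sums, so that Riemann integrals and finite covers by open
    intervals suffice. In exchange there are two auxiliary cutoffs: t > ep > 0, where the kernel is
    Lipschitz, and t < b < 1, where gamma has two-sided derivatives. The weak type constant depends
    on neither, so that they can be chosen after f and alpha; the two pieces removed are estimated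
    uniformly in x, by integration by parts near 0 and trivially near 1. *)

Record strong_phase (g0 g1 g2 : R -> R) (t1 c d : R) : Prop := {
  sp_d0 : forall t, 0 < t < 1 -> is_derive g0 t (g1 t);
  sp_d1 : forall t, 0 < t < 1 -> is_derive g1 t (g2 t);
  sp_pos : forall t, 0 < t < 1 -> 0 < g1 t;
  sp_dec : forall t t', 0 < t -> t <= t' -> t' < 1 -> g1 t' <= g1 t;
  sp_neg : forall t, 0 < t < 1 -> g2 t <= 0;
  sp_conv : forall t t', 0 < t -> t <= t' -> t' < 1 -> g2 t <= g2 t';
  sp_t1 : 0 < t1 < 1;
  sp_c : 0 < c;
  sp_d : 0 < d;
  (* [sp_growth] and [sp_gap] bound amplitude over phase derivative by t^d/c for the amplitude 1/t
     of one kernel, and by t^d/(c z) for the amplitude 1/(t(t+z)) of a correlation: the form in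
     which [van_der_corput] takes them. *)
  sp_growth : forall t, 0 < t <= t1 -> c <= t * g1 t * Rpower t d;
  sp_gap : forall t z, 0 < t <= t1 -> 0 < z -> t + z < 1 ->
    c * z <= t * (t + z) * (g1 t - g1 (t + z)) * Rpower t d
}.

(** * Consequences of (a.1) and (a.4) *)

Lemma Rpower_pos x y : 0 < Rpower x y.
Proof. apply exp_pos. Qed.

Lemma Rpower_base_mult x y z : 0 < x -> 0 < y -> Rpower (x * y) z = Rpower x z * Rpower y z.
Proof. intros; symmetry; apply Rpower_mult_distr; auto. Qed.

(** Each step from t to q t costs [g1] a factor of at least [A0] > q, so [g1] grows at least like
    t^(- ln A0 / ln q) at 0; [d] is the surplus of this exponent over 1. *)
Lemma geometric_decay_growth g1 t1 q A0 :
  1 < q -> q < A0 -> 0 < t1 ->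
  (forall t, 0 < t <= t1 -> 0 < g1 t) ->
  (forall t t', 0 < t -> t <= t' -> t' <= t1 -> g1 t' <= g1 t) ->
  (forall t, 0 < t -> q * t <= t1 -> A0 * g1 (q * t) <= g1 t) ->
  exists c d, 0 < c /\ 0 < d /\
    forall t, 0 < t <= t1 -> c <= t * g1 t * Rpower t d.
Proof.
intros Hq HA Ht1 Hpos Hdec Hq1.
assert (Hlq : 0 < ln q) by (rewrite <- ln_1; apply ln_increasing; lra).
set (d := ln A0 / ln q - 1).
assert (Hd : 0 < d).
{ unfold d. assert (ln q < ln A0) by (apply ln_increasing; lra).
  assert (1 < ln A0 / ln q) by (apply (Rmult_lt_reg_r (ln q)); [lra|]; field_simplify; lra). lra. }
assert (HA0 : A0 = q * Rpower q d).
{ rewrite <- (exp_ln A0) at 1 by lra. rewrite <- (exp_ln q) at 1 by lra.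
  unfold Rpower. rewrite <- exp_plus. f_equal. unfold d. field. lra. }
(* By [HA0], t^(1+d) g1(t) does not increase from t to q t, so only [t1/q, t1] needs a lower bound;
   [c] takes each factor at its least there. *)
set (c := t1 / q * g1 t1 * Rpower (t1 / q) d).
assert (Hg : 0 < g1 t1) by (apply Hpos; lra).
assert (Htq : 0 < t1 / q) by (apply Rdiv_lt_0_compat; lra).
assert (Hc : 0 < c).
{ unfold c. apply Rmult_lt_0_compat; [apply Rmult_lt_0_compat; auto|apply Rpower_pos]. }
exists c, d. repeat split; auto.
assert (Hn : forall n t, 0 < t <= t1 -> t1 <= q ^ n * t -> c <= t * g1 t * Rpower t d).
{ induction n as [|n IH]; intros t Ht Hn.
  - simpl in Hn. assert (t = t1) by lra. subst t.
    unfold c. apply Rmult_le_compat; [|left; apply Rpower_pos| |].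
    + left; apply Rmult_lt_0_compat; lra.
    + apply Rmult_le_compat_r; [lra|]. apply (Rmult_le_reg_r q); [lra|]. field_simplify; [nra|lra].
    + apply Rle_Rpower_l; [lra|]. split; [lra|]. apply (Rmult_le_reg_r q); [lra|]. field_simplify; [nra|lra].
  - destruct (Rle_lt_dec (q * t) t1) as [H|H].
    + assert (0 < q * t) by nra.
      eapply Rle_trans; [apply (IH (q * t)); [lra|simpl in Hn; lra]|].
      rewrite Rpower_base_mult by lra.
      replace (q * t * g1 (q * t) * (Rpower q d * Rpower t d)) with ((A0 * g1 (q * t)) * (t * Rpower t d)) by (rewrite HA0; ring).
      replace (t * g1 t * Rpower t d) with (g1 t * (t * Rpower t d)) by ring.
      apply Rmult_le_compat_r; [|apply Hq1; lra].
      left; apply Rmult_lt_0_compat; [lra|apply Rpower_pos].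
    + assert (Htq' : t1 / q <= t) by (apply (Rmult_le_reg_r q); [lra|]; field_simplify; lra).
      unfold c. apply Rmult_le_compat; [|left; apply Rpower_pos| |].
      * left; apply Rmult_lt_0_compat; lra.
      * apply Rmult_le_compat; try lra. apply Hdec; lra.
      * apply Rle_Rpower_l; lra. }
intros t Ht.
destruct (Pow_x_infinity q) with (b := t1 / t) as [N HN].
{ rewrite Rabs_pos_eq; lra. }
apply (Hn N t Ht).
specialize (HN N (le_n N)). rewrite Rabs_pos_eq in HN by (apply pow_le; lra).
apply Rge_le in HN. apply (Rmult_le_compat_r t) in HN; [|lra].
replace (t1 / t * t) with t1 in HN by (field; lra). lra.
Qed.

(** [g1] is convex, so its drop from t is concave in the step and lies above its chord. *)
Lemma convex_gap g1 g2 t z r :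
  (forall s, 0 < s < 1 -> is_derive g1 s (g2 s)) ->
  (forall s s', 0 < s -> s <= s' -> s' < 1 -> g2 s <= g2 s') ->
  0 < t -> 0 < z <= r -> t + r < 1 ->
  z * (g1 t - g1 (t + r)) <= r * (g1 t - g1 (t + z)).
Proof.
intros Hd Hc Ht Hz Hr.
destruct (Req_dec z r) as [->|Hne]; [lra|].
destruct (MVT_cor2 g1 g2 t (t + z)) as [x1 [E1 B1]]; [lra|intros; apply is_derive_Reals, Hd; lra|].
destruct (MVT_cor2 g1 g2 (t + z) (t + r)) as [x2 [E2 B2]]; [lra|intros; apply is_derive_Reals, Hd; lra|].
assert (H12 : g2 x1 <= g2 x2) by (apply Hc; lra).
assert (0 <= z * (r - z) * (g2 x2 - g2 x1)) by (apply Rmult_le_pos; [apply Rmult_le_pos|]; lra).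
replace (g1 t - g1 (t + r)) with (- (g2 x1 * (t + z - t)) - g2 x2 * (t + r - (t + z))) by lra.
replace (g1 t - g1 (t + z)) with (- (g2 x1 * (t + z - t))) by lra.
lra.
Qed.

Lemma is_derive_sign_le g l t u :
  is_derive g t l -> t < u -> (forall s, t < s < u -> g s <= g t) -> l <= 0.
Proof.
intros Hd Htu H. apply is_derive_Reals in Hd.
destruct (Rle_lt_dec l 0) as [|Hl]; [auto|exfalso].
destruct (Hd (l / 2)) as [del Hdel]; [lra|].
set (h := Rmin (del / 2) ((u - t) / 2)).
assert (0 < h) by (apply Rmin_pos; destruct del; simpl; lra).
assert (h <= del / 2) by apply Rmin_l.
assert (h <= (u - t) / 2) by apply Rmin_r.
specialize (Hdel h). destruct del as [del Hd0]; simpl in *.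
specialize (Hdel ltac:(lra)). rewrite Rabs_pos_eq in Hdel by lra.
specialize (Hdel ltac:(lra)). apply Rabs_def2 in Hdel.
assert (g (t + h) <= g t) by (apply H; lra).
assert ((g (t + h) - g t) / h <= 0).
{ apply (Rmult_le_reg_r h); [lra|]. field_simplify; lra. }
lra.
Qed.

Lemma strong_phase_intro g0 g1 g2 t0 eps A0
  (Hg0 : forall t, 0 < t < 1 -> derivable_pt_lim g0 t (g1 t))
  (Hg1 : forall t, 0 < t < 1 -> derivable_pt_lim g1 t (g2 t))
  (Ht0 : 0 < t0)
  (Ha1g2 : monotone_on in_0_1 g2)
  (Ha1pos : forall t, in_0_1 t -> 0 < g1 t)
  (Ha1dec : forall t u, in_0_1 t -> in_0_1 u -> t < u -> g1 u < g1 t)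
  (Heps : 0 < eps) (HA0 : 1 + eps < A0)
  (Ha4 : forall t, 0 < t < t0 -> (1 + eps) * t <= 1 ->
     g1 t >= A0 * g1 ((1 + eps) * t)) :
  exists t1 c d, strong_phase g0 g1 g2 t1 c d.
Proof.
assert (Hdec : forall t t', 0 < t -> t <= t' -> t' <= 1 -> g1 t' <= g1 t).
{ intros t t' H1 H2 H3. destruct (Req_dec t t') as [->|]; [lra|].
  left; apply Ha1dec; unfold in_0_1; lra. }
assert (Hneg : forall t, 0 < t < 1 -> g2 t <= 0).
{ intros t Ht. apply (is_derive_sign_le g1 _ t 1); [apply is_derive_Reals; auto|lra|].
  intros; apply Hdec; lra. }
assert (HM : 0 < Rmin t0 1) by (apply Rmin_pos; lra).
assert (HM0 := Rmin_l t0 1). assert (HM1 := Rmin_r t0 1).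
(* For t <= t1 the point (1+eps) t is at most min(t0,1)/2, so (a.4) applies and stays inside
   (0,1). *)
set (t1 := Rmin t0 1 / (2 * (1 + eps))).
assert (Ht1e : t1 * (1 + eps) = Rmin t0 1 / 2) by (unfold t1; field; lra).
assert (Ht1 : 0 < t1) by (apply Rdiv_lt_0_compat; lra).
assert (Ht1b : t1 < Rmin t0 1 / 2) by nra.
destruct (geometric_decay_growth g1 t1 (1 + eps) A0) as [c [d [Hc [Hd Hgr]]]]; try lra.
{ intros; apply Ha1pos; unfold in_0_1; lra. }
{ intros; apply Hdec; lra. }
{ intros t Ht Hq. apply Rge_le, Ha4; nra. }
assert (Hlow : forall t, 0 < t <= t1 -> c * / (t * Rpower t d) <= g1 t).
{ intros t Ht. assert (HP := Rpower_pos t d).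
  assert (0 < t * Rpower t d) by nra.
  apply (Rmult_le_reg_r (t * Rpower t d)); [auto|].
  specialize (Hgr t Ht). replace (c * / (t * Rpower t d) * (t * Rpower t d)) with c by (field; lra). lra. }
(* (a.1) leaves open in which direction gamma'' is monotone; the growth of gamma' at 0 decides
   it. *)
assert (Hconv : forall t t', 0 < t -> t <= t' -> t' < 1 -> g2 t <= g2 t').
{ destruct Ha1g2 as [H|H]; [intros; apply H; unfold in_0_1; lra|exfalso].
  (* If g2 were nonincreasing, g1 would be concave, hence bounded near 0. *)
  set (B := g1 t1 - g2 t1 + 1).
  assert (HB : 0 < B).
  { assert (g2 t1 <= 0) by (apply Hneg; lra). assert (0 < g1 t1) by (apply Ha1pos; unfold in_0_1; lra). unfold B; lra. }
  assert (Hb : forall t, 0 < t < t1 -> g1 t <= B).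
  { intros t Ht. destruct (MVT_cor2 g1 g2 t t1) as [x [E Bx]]; [lra|intros; apply Hg1; lra|].
    assert (g2 t1 <= g2 x) by (apply H; unfold in_0_1; lra).
    assert (g2 t1 <= 0) by (apply Hneg; lra). assert (g2 x <= 0) by (apply Hneg; lra). unfold B. nra. }
  (* At this t the bound [B] on gamma' gives t g1(t) t^d <= c/2, against [Hgr]. *)
  set (t := Rmin (t1 / 2) (c / (2 * B))).
  assert (Hcb : 0 < c / (2 * B)) by (apply Rdiv_lt_0_compat; lra).
  assert (0 < t) by (apply Rmin_pos; lra).
  assert (t <= t1 / 2) by apply Rmin_l.
  assert (Htc : t <= c / (2 * B)) by apply Rmin_r.
  assert (HBt : B * t <= c / 2).
  { apply (Rmult_le_compat_l B) in Htc; [|lra].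
    replace (B * (c / (2 * B))) with (c / 2) in Htc by (field; lra). lra. }
  assert (Rpower t d <= 1).
  { replace 1 with (Rpower 1 d).
    - apply Rle_Rpower_l; lra.
    - unfold Rpower; rewrite ln_1, Rmult_0_r; apply exp_0. }
  assert (HP := Rpower_pos t d).
  specialize (Hgr t ltac:(lra)). specialize (Hb t ltac:(lra)).
  assert (0 < g1 t) by (apply Ha1pos; unfold in_0_1; lra).
  assert (t * g1 t <= c / 2) by nra.
  assert (0 < t * g1 t) by nra.
  nra. }
set (k := (1 - / A0)).
assert (HiA : / A0 < 1) by (rewrite <- Rinv_1; apply Rinv_lt_contravar; lra).
assert (HiA0 : 0 < / A0) by (apply Rinv_0_lt_compat; lra).
assert (Hk : 0 < k < 1) by (unfold k; lra).
assert (Hdrop : forall t, 0 < t <= t1 -> k * g1 t <= g1 t - g1 (t + eps * t)).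
{ intros t Ht. replace (t + eps * t) with ((1 + eps) * t) by ring.
  assert (H4 : g1 t >= A0 * g1 ((1 + eps) * t)) by (apply Ha4; nra).
  assert (g1 ((1 + eps) * t) <= / A0 * g1 t).
  { apply (Rmult_le_reg_l A0); [lra|]. field_simplify; lra. }
  unfold k; lra. }
(* [m] serves both cases of [Hgap]: for z <= eps t convexity loses a factor eps, and m eps <= 1; for
   z > eps t the full drop k g1(t) is available, and m z <= t + z. *)
set (m := Rmin 1 (/ eps)).
assert (Hm : 0 < m) by (apply Rmin_pos; [lra|apply Rinv_0_lt_compat; lra]).
assert (Hm1 : m <= 1) by apply Rmin_l.
assert (Hme : m * eps <= 1).
{ assert (m <= / eps) by apply Rmin_r. apply (Rmult_le_compat_r eps) in H; [|lra].
  rewrite Rinv_l in H; lra. }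
exists t1, (k * m * c), d.
assert (Hkm : 0 < k * m) by (apply Rmult_lt_0_compat; lra).
assert (Hkm1 : k * m <= 1) by nra.
constructor; try lra; auto.
- intros; apply is_derive_Reals; auto.
- intros; apply is_derive_Reals; auto.
- intros; apply Ha1pos; unfold in_0_1; lra.
- intros; apply Hdec; lra.
- repeat apply Rmult_lt_0_compat; lra.
- intros t Ht. specialize (Hgr t Ht). nra.
- intros t z Ht Hz Htz.
  assert (HP := Rpower_pos t d). specialize (Hgr t Ht).
  assert (Hgt : 0 < g1 t) by (apply Ha1pos; unfold in_0_1; lra).
  specialize (Hdrop t Ht).
  assert (Hgap : k * m * z * g1 t <= (t + z) * (g1 t - g1 (t + z))).
  { assert (Hkg : 0 < k * g1 t) by nra.
    destruct (Rle_lt_dec z (eps * t)) as [Hze|Hze].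
    - assert (Hcv : z * (g1 t - g1 (t + eps * t)) <= eps * t * (g1 t - g1 (t + z))).
      { apply (convex_gap g1 g2); try lra; auto; [intros; apply is_derive_Reals; auto|nra]. }
      assert (H0 : 0 <= g1 t - g1 (t + z)) by (assert (g1 (t + z) <= g1 t) by (apply Hdec; lra); lra).
      assert (z * (k * g1 t) <= eps * (t * (g1 t - g1 (t + z)))) by nra.
      assert (m * (z * (k * g1 t)) <= m * (eps * (t * (g1 t - g1 (t + z))))) by (apply Rmult_le_compat_l; lra).
      assert (0 <= t * (g1 t - g1 (t + z))) by nra.
      nra.
    - assert (g1 (t + z) <= g1 (t + eps * t)) by (apply Hdec; nra).
      assert (k * g1 t <= g1 t - g1 (t + z)) by lra.
      assert (m * z <= t + z) by nra.
      assert (0 < m * z) by nra.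
      apply Rle_trans with ((m * z) * (k * g1 t)); [lra|]. nra. }
  apply Rle_trans with (k * m * z * (t * g1 t * Rpower t d)).
  + replace (k * m * c * z) with (k * m * z * c) by ring.
    apply Rmult_le_compat_l; [nra|auto].
  + replace (k * m * z * (t * g1 t * Rpower t d)) with ((k * m * z * g1 t) * (t * Rpower t d)) by ring.
    replace (t * (t + z) * (g1 t - g1 (t + z)) * Rpower t d) with ((t + z) * (g1 t - g1 (t + z)) * (t * Rpower t d)) by ring.
    apply Rmult_le_compat_r; [nra|auto].
Qed.

(** * Van der Corput's lemma *)

Lemma is_derive_nonneg_incr h h' s1 s2 :
  s1 <= s2 ->
  (forall t, s1 <= t <= s2 -> is_derive h t (h' t) /\ 0 <= h' t) ->
  h s1 <= h s2.
Proof.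
intros H12 H. destruct (Req_dec s1 s2) as [->|]; [lra|].
destruct (MVT_cor2 h h' s1 s2) as [x [E B]]; [lra|intros; apply is_derive_Reals, H; lra|].
assert (0 <= h' x) by (apply H; lra). nra.
Qed.

Lemma is_derive_continuous_R (f : R -> R) x l : is_derive f x l -> continuous f x.
Proof. intros H. apply (ex_derive_continuous f). exists l; auto. Qed.

Lemma ex_RInt_continuous_on (f : R -> R) lo hi a b :
  (forall t, lo < t < hi -> continuous f t) -> lo < a < hi -> lo < b < hi ->
  ex_RInt f a b.
Proof.
intros Hc Ha Hb. apply (ex_RInt_continuous f). intros z Hz. apply Hc.
unfold Rmin, Rmax in Hz; destruct (Rle_dec a b); lra.
Qed.

Lemma is_derive_RInt_on (f : R -> R) lo hi a t :
  (forall t, lo < t < hi -> continuous f t) -> lo < a < hi -> lo < t < hi ->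
  is_derive (fun t => RInt f a t) t (f t).
Proof.
intros Hc Ha Ht. apply (is_derive_RInt f (fun t => RInt f a t) a t).
- assert (Hlo : locally t (fun y => lo < y < hi)).
  { apply (open_and (fun y => lo < y) (fun y => y < hi)); [apply open_gt|apply open_lt|auto]. }
  revert Hlo. apply filter_imp. intros y Hy.
  apply (RInt_correct f). apply (ex_RInt_continuous_on f lo hi); auto.
- auto.
Qed.

Lemma continuous_cos_comp (f : R -> R) x : continuous f x -> continuous (fun t => cos (f t)) x.
Proof. intros H. apply (continuous_comp f cos); auto. apply continuous_cos. Qed.

Lemma is_derive_Rpower t d : 0 < t -> is_derive (fun t => Rpower t d) t (d * (Rpower t d / t)).
Proof.
intros Ht. unfold Rpower. auto_derive; [auto|]. field; lra.
Qed.

(* The term -a'/D in the variation of a/D is dominated by 2 a/(t D), whose integral is controlled by the power of t. *)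
Lemma van_der_corput (Phi D d a a' : R -> R) lo hi s1 s2 M dl :
  0 < s1 -> s1 <= s2 -> lo < s1 -> s2 < hi -> 0 < dl ->
  (forall t, lo < t < hi ->
    is_derive Phi t (D t) /\ is_derive D t (d t) /\ is_derive a t (a' t)) ->
  (forall t, s1 <= t <= s2 ->
    0 < D t /\ d t <= 0 /\ 0 <= a t /\ a' t <= 0 /\ - a' t * t <= 2 * a t /\
    a t <= M * Rpower t dl * D t) ->
  Rabs (RInt (fun t => cos (Phi t) * a t) s1 s2) <= (2 + 4 / dl) * M * Rpower s2 dl.
Proof.
intros Hs1 H12 Hlo Hhi Hdl Hder Hb.
set (f := fun t => cos (Phi t) * a t).
assert (Hc : forall t, lo < t < hi -> continuous f t).
{ intros t Ht. destruct (Hder t Ht) as (HP & HD & Ha).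
  apply (continuous_mult (fun t => cos (Phi t)) a).
  - apply continuous_cos_comp. eapply is_derive_continuous_R; eauto.
  - eapply is_derive_continuous_R; eauto. }
set (W := fun t => a t / D t).
set (W' := fun t => (a' t * D t - a t * d t) / (D t)^2).
(* [W] need not be monotone, but its decreasing part is at most P'/2, so |W'| <= W' + P', whose
   integral is explicit. *)
set (P := fun t => 4 * M / dl * Rpower t dl).
set (P' := fun t => 4 * M * (Rpower t dl / t)).
set (F := fun t => RInt f s1 t).
assert (HW : forall t, s1 <= t <= s2 -> is_derive W t (W' t)).
{ intros t Ht. destruct (Hder t ltac:(lra)) as (HP & HD & Ha).
  destruct (Hb t Ht) as (HDp & _).
  apply is_derive_div; auto. lra. }
assert (HP : forall t, s1 <= t <= s2 -> is_derive P t (P' t)).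
{ intros t Ht. unfold P, P'.
  replace (4 * M * (Rpower t dl / t)) with (4 * M / dl * (dl * (Rpower t dl / t))) by (field; lra).
  apply (is_derive_scal (fun t => Rpower t dl) t (4 * M / dl)). apply is_derive_Rpower; lra. }
assert (HF : forall t, s1 <= t <= s2 -> is_derive F t (f t)).
{ intros t Ht. apply (is_derive_RInt_on f lo hi); auto; lra. }
assert (HPsi : forall t, s1 <= t <= s2 ->
  is_derive (fun t => sin (Phi t) * W t) t (f t + sin (Phi t) * W' t)).
{ intros t Ht. destruct (Hder t ltac:(lra)) as (HPh & HD & Ha).
  destruct (Hb t Ht) as (HDp & _).
  replace (f t + sin (Phi t) * W' t) with ((D t * cos (Phi t)) * W t + sin (Phi t) * W' t)
    by (unfold f, W; field; lra).
  apply (is_derive_mult (fun t => sin (Phi t)) W); auto.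
  - apply (is_derive_comp sin Phi); auto. apply is_derive_sin.
  - intros; apply Rmult_comm. }
assert (Hvar : forall t, s1 <= t <= s2 -> Rabs (sin (Phi t) * W' t) <= W' t + P' t).
{ intros t Ht. destruct (Hb t Ht) as (HDp & Hd & Ha & Ha' & Hk & HM).
  assert (HQ : 0 <= - a' t / D t <= P' t / 2).
  { split.
    - apply Rmult_le_pos; [lra|left; apply Rinv_0_lt_compat; auto].
    - unfold P'. apply (Rmult_le_reg_r (t * D t)); [nra|].
      replace (- a' t / D t * (t * D t)) with (- a' t * t) by (field; lra).
      replace (4 * M * (Rpower t dl / t) / 2 * (t * D t)) with (2 * (M * Rpower t dl * D t)) by (field; lra).
      lra. }
  assert (HR : 0 <= a t * (- d t) / (D t)^2).
  { apply Rmult_le_pos; [nra|left; apply Rinv_0_lt_compat; nra]. }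
  assert (HWe : W' t = - (- a' t / D t) + a t * (- d t) / (D t)^2) by (unfold W'; field; lra).
  rewrite Rabs_mult.
  assert (Rabs (sin (Phi t)) <= 1) by (apply Rabs_le; apply SIN_bound).
  assert (Rabs (W' t) <= W' t + P' t) by (apply Rabs_le; lra).
  assert (0 <= Rabs (W' t)) by apply Rabs_pos. nra. }
assert (F s1 = 0) by (unfold F; rewrite RInt_point; reflexivity).
(* Integration by parts in the form of two monotonicity statements, comparing [F] with sin(Phi) W
   plus or minus (W + P): W' is not known to be continuous, so it is never integrated. *)
assert (HU : F s2 - F s1 <= sin (Phi s2) * W s2 - sin (Phi s1) * W s1 + (W s2 - W s1) + (P s2 - P s1)).
{ assert (sin (Phi s1) * W s1 + W s1 + P s1 - F s1 <= sin (Phi s2) * W s2 + W s2 + P s2 - F s2); [|lra].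
  apply (is_derive_nonneg_incr (fun t => sin (Phi t) * W t + W t + P t - F t)
    (fun t => f t + sin (Phi t) * W' t + W' t + P' t - f t)); auto.
  intros t Ht. split.
  - apply (is_derive_minus (fun t => sin (Phi t) * W t + W t + P t) F); auto.
    apply (is_derive_plus (fun t => sin (Phi t) * W t + W t) P); auto.
    apply (is_derive_plus (fun t => sin (Phi t) * W t) W); auto.
  - specialize (Hvar t Ht). apply Rabs_le_between in Hvar. lra. }
assert (HL : sin (Phi s2) * W s2 - sin (Phi s1) * W s1 - (W s2 - W s1) - (P s2 - P s1) <= F s2 - F s1).
{ assert (F s1 - sin (Phi s1) * W s1 + W s1 + P s1 <= F s2 - sin (Phi s2) * W s2 + W s2 + P s2); [|lra].
  apply (is_derive_nonneg_incr (fun t => F t - sin (Phi t) * W t + W t + P t)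
    (fun t => f t - (f t + sin (Phi t) * W' t) + W' t + P' t)); auto.
  intros t Ht. split.
  - apply (is_derive_plus (fun t => F t - sin (Phi t) * W t + W t) P); auto.
    apply (is_derive_plus (fun t => F t - sin (Phi t) * W t) W); auto.
    apply (is_derive_minus F (fun t => sin (Phi t) * W t)); auto.
  - specialize (Hvar t Ht). apply Rabs_le_between in Hvar. lra. }
assert (HWs : forall t, s1 <= t <= s2 -> 0 <= W t <= M * Rpower t dl).
{ intros t Ht. destruct (Hb t Ht) as (HDp & Hd & Ha & Ha' & Hk & HM). unfold W. split.
  - apply Rmult_le_pos; [lra|left; apply Rinv_0_lt_compat; auto].
  - apply (Rmult_le_reg_r (D t)); [auto|]. replace (a t / D t * D t) with (a t) by (field; lra). lra. }
assert (HW1 := HWs s1 ltac:(lra)). assert (HW2 := HWs s2 ltac:(lra)).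
assert (HP1 : 0 <= P s1).
{ unfold P. replace (4 * M / dl * Rpower s1 dl) with (4 / dl * (M * Rpower s1 dl)) by (field; lra).
  apply Rmult_le_pos; [|lra]. apply Rmult_le_pos; [lra|left; apply Rinv_0_lt_compat; auto]. }
replace ((2 + 4 / dl) * M * Rpower s2 dl) with (2 * (M * Rpower s2 dl) + P s2) by (unfold P; field; lra).
assert (S1 := SIN_bound (Phi s1)). assert (S2 := SIN_bound (Phi s2)).
fold (F s2). apply Rabs_le.
assert (- W s2 <= sin (Phi s2) * W s2 <= W s2) by nra.
assert (- W s1 <= sin (Phi s1) * W s1 <= W s1) by nra.
lra.
Qed.

(** * Correlations of truncated kernels *)

(** The real part of k(t) times the conjugate of k(t + z). *)
Definition corr (g0 : R -> R) (z t : R) := cos (g0 t - g0 (t + z)) * / (t * (t + z)).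

Lemma is_derive_shift (f f' : R -> R) z t :
  is_derive f (t + z) (f' (t + z)) -> is_derive (fun t => f (t + z)) t (f' (t + z)).
Proof.
intros H. replace (f' (t + z)) with (1 * f' (t + z)) by ring.
apply (is_derive_comp f (fun t => t + z)); auto. auto_derive; auto.
Qed.

Lemma is_RInt_inv_sqr a b : 0 < a -> a <= b -> is_RInt (fun t => / (t * t)) a b (/ a - / b).
Proof.
intros Ha Hb. replace (/ a - / b) with (- / b - - / a) by ring.
assert (Hab : Rmin a b = a /\ Rmax a b = b) by (unfold Rmin, Rmax; destruct (Rle_dec a b); lra).
destruct Hab as [E1 E2].
apply (is_RInt_derive (fun t => - / t) (fun t => / (t * t))); rewrite E1, E2; intros x Hx.
- auto_derive; [lra|]. field; lra.
- apply (is_derive_continuous_R _ _ (- (2 * / (x * x * x)))). auto_derive; [nra|]. field; lra.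
Qed.

Section CorrelationIntegral.

Context {g0 g1 g2 : R -> R} {t1 c d : R} (Hph : strong_phase g0 g1 g2 t1 c d).

Lemma corr_continuous z t : 0 <= z -> 0 < t < 1 - z -> continuous (corr g0 z) t.
Proof.
intros Hz Ht. apply (continuous_mult (fun t => cos (g0 t - g0 (t + z))) (fun t => / (t * (t + z)))).
- apply continuous_cos_comp.
  apply (is_derive_continuous_R _ _ (g1 t - g1 (t + z))).
  apply (is_derive_minus g0 (fun t => g0 (t + z))).
  + apply (sp_d0 _ _ _ _ _ _ Hph); lra.
  + apply is_derive_shift. apply (sp_d0 _ _ _ _ _ _ Hph); lra.
- apply (is_derive_continuous_R _ _ (- (2 * t + z) / (t * (t + z))^2)).
  auto_derive; [nra|]. field; lra.
Qed.

Lemma corr_ex_RInt z p q : 0 <= z -> 0 < p -> p <= q -> q + z < 1 -> ex_RInt (corr g0 z) p q.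
Proof.
intros. apply (ex_RInt_continuous_on _ 0 (1 - z)); try lra.
intros; apply corr_continuous; lra.
Qed.

Lemma corr_trivial_bound z p q : 0 <= z -> 0 < p -> p <= q -> q + z < 1 ->
  Rabs (RInt (corr g0 z) p q) <= / p.
Proof.
intros Hz Hp Hpq Hq.
apply Rle_trans with (/ p - / q).
- apply (norm_RInt_le (corr g0 z) (fun t => / (t * t)) p q); auto.
  + intros t Ht. change norm with Rabs. unfold corr. rewrite Rabs_mult.
    assert (Rabs (cos (g0 t - g0 (t + z))) <= 1) by (apply Rabs_le, COS_bound).
    rewrite (Rabs_pos_eq (/ _)) by (left; apply Rinv_0_lt_compat; nra).
    assert (/ (t * (t + z)) <= / (t * t)) by (apply Rinv_le_contravar; nra).
    assert (0 < / (t * (t + z))) by (apply Rinv_0_lt_compat; nra).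
    nra.
  + apply (RInt_correct (corr g0 z)). apply corr_ex_RInt; auto.
  + apply is_RInt_inv_sqr; auto.
- assert (0 < / q) by (apply Rinv_0_lt_compat; lra). lra.
Qed.

(** The phase derivative gamma'(t) - gamma'(t+z) is positive by [sp_gap] and nonincreasing because
    gamma' is convex, so van der Corput applies with M = 1/(c z). *)
Lemma corr_osc_bound z p q : 0 < z -> 0 < p -> p <= q -> q + z < 1 -> q <= t1 ->
  Rabs (RInt (corr g0 z) p q) <= (2 + 4 / d) * / (c * z) * Rpower q d.
Proof.
intros Hz Hp Hpq Hq Hqt.
assert (Hc := sp_c _ _ _ _ _ _ Hph).
apply (van_der_corput (fun t => g0 t - g0 (t + z)) (fun t => g1 t - g1 (t + z)) (fun t => g2 t - g2 (t + z))
  (fun t => / (t * (t + z))) (fun t => - (2 * t + z) / (t * (t + z))^2) 0 (1 - z)); try lra.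
- apply (sp_d _ _ _ _ _ _ Hph).
- intros t Ht. split; [|split].
  + apply (is_derive_minus g0 (fun t => g0 (t + z))).
    * apply (sp_d0 _ _ _ _ _ _ Hph); lra.
    * apply is_derive_shift. apply (sp_d0 _ _ _ _ _ _ Hph); lra.
  + apply (is_derive_minus g1 (fun t => g1 (t + z))).
    * apply (sp_d1 _ _ _ _ _ _ Hph); lra.
    * apply is_derive_shift. apply (sp_d1 _ _ _ _ _ _ Hph); lra.
  + auto_derive; [nra|]. field; lra.
- intros t Ht.
  assert (Hg := sp_gap _ _ _ _ _ _ Hph t z ltac:(lra) Hz ltac:(lra)).
  assert (HR := Rpower_pos t d).
  assert (Htz : 0 < t * (t + z)) by nra.
  assert (HD : 0 < g1 t - g1 (t + z)).
  { assert (0 < c * z) by nra.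
    apply (Rmult_lt_reg_l (t * (t + z) * Rpower t d)); [nra|]. rewrite Rmult_0_r.
    replace (t * (t + z) * Rpower t d * (g1 t - g1 (t + z))) with (t * (t + z) * (g1 t - g1 (t + z)) * Rpower t d) by ring. lra. }
  repeat split.
  + auto.
  + assert (g2 t <= g2 (t + z)) by (apply (sp_conv _ _ _ _ _ _ Hph); lra). lra.
  + left; apply Rinv_0_lt_compat; auto.
  + assert (0 < (2 * t + z) / (t * (t + z))^2) by (apply Rdiv_lt_0_compat; [lra|nra]).
    replace (- (2 * t + z) / (t * (t + z)) ^ 2) with (- ((2 * t + z) / (t * (t + z)) ^ 2)) by (field; lra). lra.
  + apply (Rmult_le_reg_r ((t * (t + z))^2)); [nra|].
    replace (- (- (2 * t + z) / (t * (t + z)) ^ 2) * t * (t * (t + z)) ^ 2) with ((2 * t + z) * t) by (field; lra).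
    replace (2 * / (t * (t + z)) * (t * (t + z)) ^ 2) with (2 * (t * (t + z))) by (field; lra).
    nra.
  + apply (Rmult_le_reg_r (t * (t + z) * (c * z))); [apply Rmult_lt_0_compat; nra|].
    replace (/ (t * (t + z)) * (t * (t + z) * (c * z))) with (c * z) by (field; lra).
    replace (/ (c * z) * Rpower t d * (g1 t - g1 (t + z)) * (t * (t + z) * (c * z)))
      with (t * (t + z) * (g1 t - g1 (t + z)) * Rpower t d) by (field; lra). lra.
Qed.

(* The exponent th = d/(1+d) balances the two bounds at the splitting point t1 z^(1-th). *)
Lemma corr_bound z p q : 0 < z -> 0 < p -> p <= q -> q + z < 1 ->
  Rabs (RInt (corr g0 z) p q) <= (/ t1 + (2 + 4 / d) * / c) * Rpower z (d / (1 + d) - 1).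
Proof.
intros Hz Hp Hpq Hq.
assert (Hc := sp_c _ _ _ _ _ _ Hph). assert (Hd := sp_d _ _ _ _ _ _ Hph).
assert (Ht1 := sp_t1 _ _ _ _ _ _ Hph).
set (th := d / (1 + d)).
set (s := t1 * Rpower z (1 - th)).
assert (Hth : (1 - th) * d = th) by (unfold th; field; lra).
assert (Hth0 : 0 < th) by (apply Rdiv_lt_0_compat; lra).
assert (Hth1 : 0 < 1 - th) by (replace (1 - th) with (/ (1 + d)) by (unfold th; field; lra); apply Rinv_0_lt_compat; lra).
assert (HZ := Rpower_pos z (1 - th)).
assert (HZ1 : Rpower z (1 - th) <= 1).
{ replace 1 with (Rpower 1 (1 - th)) at 2.
  - apply Rle_Rpower_l; lra.
  - unfold Rpower; rewrite ln_1, Rmult_0_r; apply exp_0. }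
assert (Hs : 0 < s) by (apply Rmult_lt_0_compat; lra).
assert (Hst : s <= t1) by (unfold s; nra).
assert (HZi : Rpower z (th - 1) = / Rpower z (1 - th)).
{ rewrite <- Rpower_Ropp. f_equal; ring. }
assert (Hsi : / s = / t1 * Rpower z (th - 1)).
{ rewrite HZi. unfold s. field. lra. }
assert (Hk : 0 < 2 + 4 / d) by (assert (0 < 4 / d) by (apply Rdiv_lt_0_compat; lra); lra).
assert (Hci : 0 < / c) by (apply Rinv_0_lt_compat; lra).
assert (Hosc : (2 + 4 / d) * / (c * z) * Rpower s d <= (2 + 4 / d) * / c * Rpower z (th - 1)).
{ replace (Rpower z (th - 1)) with (Rpower z th * / z).
  2:{ unfold Rminus. rewrite Rpower_plus, Rpower_Ropp, Rpower_1; auto. }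
  rewrite Rinv_mult, Rmult_assoc, Rmult_assoc, Rmult_assoc.
  apply Rmult_le_compat_l; [lra|]. apply Rmult_le_compat_l; [lra|].
  rewrite (Rmult_comm (Rpower z th)). apply Rmult_le_compat_l; [left; apply Rinv_0_lt_compat; auto|].
  unfold s. rewrite Rpower_base_mult by lra. rewrite Rpower_mult, Hth.
  assert (Rpower t1 d <= 1).
  { replace 1 with (Rpower 1 d).
    - apply Rle_Rpower_l; lra.
    - unfold Rpower; rewrite ln_1, Rmult_0_r; apply exp_0. }
  assert (HP := Rpower_pos z th). nra. }
assert (Htr : 0 < / s) by (apply Rinv_0_lt_compat; auto).
assert (Hos : 0 < (2 + 4 / d) * / (c * z) * Rpower s d).
{ apply Rmult_lt_0_compat; [apply Rmult_lt_0_compat; [lra|apply Rinv_0_lt_compat; nra]|apply Rpower_pos]. }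
rewrite Rmult_plus_distr_r, <- Hsi.
assert (Hosc' : forall q', p <= q' -> q' <= s -> q' + z < 1 ->
  Rabs (RInt (corr g0 z) p q') <= (2 + 4 / d) * / c * Rpower z (th - 1)).
{ intros q' H1 H2 H3. eapply Rle_trans; [apply corr_osc_bound; lra|].
  eapply Rle_trans; [|apply Hosc]. apply Rmult_le_compat_l.
  - left; apply Rmult_lt_0_compat; [lra|apply Rinv_0_lt_compat; nra].
  - apply Rle_Rpower_l; lra. }
destruct (Rle_lt_dec s p) as [Hsp|Hsp].
- assert (/ p <= / s) by (apply Rinv_le_contravar; lra).
  assert (H' := corr_trivial_bound z p q ltac:(lra) Hp Hpq Hq). lra.
- destruct (Rle_lt_dec q s) as [Hqs|Hqs].
  + assert (H := Hosc' q Hpq Hqs Hq). lra.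
  + assert (H := Hosc' s ltac:(lra) ltac:(lra) ltac:(lra)).
    assert (H' := corr_trivial_bound z s q ltac:(lra) Hs ltac:(lra) Hq).
    rewrite <- (RInt_Chasles (corr g0 z) p s q).
    * change plus with Rplus. eapply Rle_trans; [apply Rabs_triang|]. lra.
    * apply corr_ex_RInt; lra.
    * apply corr_ex_RInt; lra.
Qed.

End CorrelationIntegral.

Definition trunc (l b : R) (f : R -> R) (t : R) : R :=
  if Rlt_dec l t then if Rlt_dec t b then f t else 0 else 0.

Lemma trunc_in l b f t : l < t < b -> trunc l b f t = f t.
Proof. intros H. unfold trunc. destruct (Rlt_dec l t), (Rlt_dec t b); lra. Qed.

Lemma trunc_out l b f t : t <= l \/ b <= t -> trunc l b f t = 0.
Proof. intros H. unfold trunc. destruct (Rlt_dec l t), (Rlt_dec t b); lra. Qed.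

(** Real and imaginary part of k on (l, b), to be used with b < 1. *)
Definition kcos (g0 : R -> R) l b := trunc l b (fun t => cos (g0 t) / t).
Definition ksin (g0 : R -> R) l b := trunc l b (fun t => sin (g0 t) / t).

Lemma is_RInt_vanishing (g : R -> R) a b :
  (forall x, Rmin a b < x < Rmax a b -> g x = 0) -> is_RInt g a b 0.
Proof.
intros H. apply (is_RInt_ext (fun _ => 0)).
- intros x Hx; symmetry; auto.
- assert (H0 := is_RInt_const (V := R_NormedModule) a b 0).
  unfold scal in H0; simpl in H0; unfold mult in H0; simpl in H0.
  rewrite Rmult_0_r in H0. exact H0.
Qed.

Lemma is_RInt_supported (g h : R -> R) A L U B J :
  A <= L -> L <= U -> U <= B -> is_RInt h L U J ->
  (forall x, L < x < U -> g x = h x) ->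
  (forall x, A < x < L \/ U < x < B -> g x = 0) ->
  is_RInt g A B J.
Proof.
intros H1 H2 H3 Hh Hin Hout.
assert (E : forall a b, a <= b -> Rmin a b = a /\ Rmax a b = b).
{ intros; unfold Rmin, Rmax; destruct (Rle_dec a b); lra. }
replace J with (plus (plus 0 J) 0) by (unfold plus; simpl; ring).
apply (is_RInt_Chasles g A U B); [apply (is_RInt_Chasles g A L U)|].
- apply is_RInt_vanishing. intros x. destruct (E A L H1) as [-> ->]. auto.
- apply (is_RInt_ext h); auto. intros x. destruct (E L U H2) as [-> ->]. intros; symmetry; auto.
- apply is_RInt_vanishing. intros x. destruct (E U B H3) as [-> ->]. auto.
Qed.

Lemma is_RInt_shift (H : R -> R) v p q J :
  is_RInt H p q J -> is_RInt (fun x => H (x - v)) (v + p) (v + q) J.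
Proof.
intros HJ.
apply (is_RInt_ext (fun x => scal 1 (H (1 * x + - v)))).
- intros x _. unfold scal; simpl; unfold mult; simpl. rewrite Rmult_1_l. f_equal. ring.
- apply (is_RInt_comp_lin H 1 (- v)).
  replace (1 * (v + p) + - v) with p by ring. replace (1 * (v + q) + - v) with q by ring. auto.
Qed.

Lemma Rpower_neg_le z w e : e <= 0 -> 0 < w -> w <= z -> Rpower z e <= Rpower w e.
Proof.
intros He Hw Hz. replace e with (- (- e)) by ring. rewrite (Rpower_Ropp z), (Rpower_Ropp w).
apply Rinv_le_contravar; [apply Rpower_pos|]. apply Rle_Rpower_l; lra.
Qed.

(** The real part of one translated kernel times the conjugate of the other. Cosine and sine are
    taken together because the sum contains only the difference of the phases, while either product
    alone also contains their sum. *)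
Definition pair_kernel g0 b l l' y y' x :=
  kcos g0 l b (x - y) * kcos g0 l' b (x - y') + ksin g0 l b (x - y) * ksin g0 l' b (x - y').

Lemma pair_kernel_sym g0 b l l' y y' x :
  pair_kernel g0 b l l' y y' x = pair_kernel g0 b l' l y' y x.
Proof. unfold pair_kernel; ring. Qed.

(** [z] is the distance of the centres and [m] the larger cutoff. The guard 0 < z excludes the
    diagonal, where [Rpower 0] is a default value. *)
Definition correlation_bound (C th m z J : R) :=
  Rabs J <= C / m /\ (0 < z -> Rabs J <= C * Rpower z (th - 1)) /\
  (1 <= z -> J = 0) /\ (1 <= m -> J = 0).

Lemma pair_correlation_ordered g0 g1 g2 t1 c d : strong_phase g0 g1 g2 t1 c d ->
  exists C th, 0 < C /\ 0 < th < 1 /\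
  forall b l l' y y' A B, b < 1 -> 0 < l -> 0 < l' -> y <= y' -> A <= y' -> y' + 1 <= B ->
  exists J, is_RInt (pair_kernel g0 b l l' y y') A B J /\
    correlation_bound C th (Rmax l l') (y' - y) J.
Proof.
intros Hph.
assert (Hc := sp_c _ _ _ _ _ _ Hph). assert (Hd := sp_d _ _ _ _ _ _ Hph).
assert (Ht1 := sp_t1 _ _ _ _ _ _ Hph).
set (th := d / (1 + d)).
assert (Hth0 : 0 < th) by (apply Rdiv_lt_0_compat; lra).
assert (Hth1 : 0 < 1 - th) by (replace (1 - th) with (/ (1 + d)) by (unfold th; field; lra); apply Rinv_0_lt_compat; lra).
set (CB := / t1 + (2 + 4 / d) * / c).
assert (HCB : 0 < CB).
{ assert (0 < / t1) by (apply Rinv_0_lt_compat; lra).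
  assert (0 < / c) by (apply Rinv_0_lt_compat; lra).
  assert (0 < 4 / d) by (apply Rdiv_lt_0_compat; lra). unfold CB; nra. }
exists (2 + 2 * CB), th. split; [lra|split; [lra|]].
intros b l l' y y' A B Hb Hl Hl' Hy HA HB.
set (z := y' - y). assert (Hz : 0 <= z) by (unfold z; lra).
(* In the variable t = x - y' the other argument is t + z, and the product lives on p < t < q. *)
set (p := Rmax l' (l - z)). set (q := b - z).
assert (Hp1 : l' <= p) by apply Rmax_l. assert (Hp2 : l - z <= p) by apply Rmax_r.
assert (Hpc : p = l' \/ p = l - z) by (unfold p, Rmax; destruct (Rle_dec l' (l - z)); auto).
assert (Hm1 : l <= Rmax l l') by apply Rmax_l. assert (Hm2 : l' <= Rmax l l') by apply Rmax_r.
assert (Hmc : Rmax l l' = l \/ Rmax l l' = l') by (unfold Rmax; destruct (Rle_dec l l'); auto).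
assert (Hout : forall x, x - y' <= p \/ q <= x - y' -> pair_kernel g0 b l l' y y' x = 0).
{ intros x Hx. unfold pair_kernel, kcos, ksin.
  assert (Hx' : (x - y <= l \/ b <= x - y) \/ (x - y' <= l' \/ b <= x - y')).
  { unfold q, z in *. destruct Hx as [Hx|Hx]; [|left; right; lra].
    destruct Hpc as [E|E]; [right; left; lra|left; left; lra]. }
  destruct Hx' as [Hx'|Hx'].
  - rewrite !(trunc_out l b) by auto. ring.
  - rewrite !(trunc_out l' b) by auto. ring. }
destruct (Rle_lt_dec q p) as [Hqp|Hpq].
- exists 0. split.
  + apply is_RInt_vanishing. intros x _. apply Hout. lra.
  + unfold correlation_bound. rewrite Rabs_R0. split; [|split; [|auto]].
    * apply Rlt_le, Rdiv_lt_0_compat; lra.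
    * intros _. apply Rmult_le_pos; [lra|left; apply Rpower_pos].
- assert (Hbz : q + z < 1) by (unfold q; lra).
  exists (RInt (corr g0 z) p q). split.
  + apply (is_RInt_supported _ (fun x => corr g0 z (x - y')) A (y' + p) (y' + q) B).
    * lra.
    * lra.
    * unfold q; lra.
    * apply is_RInt_shift. apply (RInt_correct (corr g0 z)). apply (corr_ex_RInt Hph); lra.
    * intros x Hx. unfold pair_kernel, kcos, ksin, corr.
      assert (Hx1 : l < x - y < b) by (unfold q, z in *; lra).
      assert (Hx2 : l' < x - y' < b) by (unfold q, z in *; lra).
      rewrite !(trunc_in l b), !(trunc_in l' b) by auto.
      replace (x - y' + z) with (x - y) by (unfold z; ring).
      rewrite cos_minus. field; lra.
    * intros x Hx. apply Hout. lra.
  + assert (HT := corr_trivial_bound Hph z p q Hz ltac:(lra) ltac:(lra) Hbz).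
    assert (HO : 0 < z -> Rabs (RInt (corr g0 z) p q) <= CB * Rpower z (th - 1)).
    { intros; apply (corr_bound Hph); lra. }
    assert (Hm : Rmax l l' < 1).
    { unfold q in Hpq. destruct Hmc as [->| ->]; lra. }
    split; [|split; [|split]].
    * apply Rle_trans with (2 / Rmax l l' + 2 * CB / Rmax l l'); [|apply Req_le; field; lra].
      assert (0 < 2 / Rmax l l') by (apply Rdiv_lt_0_compat; lra).
      assert (0 < 2 * CB / Rmax l l') by (apply Rdiv_lt_0_compat; lra).
      (* The trivial bound is 1/p, and p may be far below m = max(l, l'). But p < m/2 forces m = l
         and z > m/2, and then z^(th-1) is itself at most 2/m because m < 1. *)
      destruct (Rle_lt_dec (Rmax l l' / 2) p) as [Hpm|Hpm].
      -- assert (/ p <= 2 / Rmax l l').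
         { replace (2 / Rmax l l') with (/ (Rmax l l' / 2)) by (field; lra).
           apply Rinv_le_contravar; lra. }
         lra.
      -- assert (Hzm : Rmax l l' / 2 < z) by (destruct Hmc; lra).
         assert (Rpower z (th - 1) <= 2 / Rmax l l').
         { apply Rle_trans with (Rpower (Rmax l l' / 2) (th - 1)); [apply Rpower_neg_le; lra|].
           replace (2 / Rmax l l') with (/ (Rmax l l' / 2)) by (field; lra).
           replace (th - 1) with (- (1 - th)) by ring. rewrite Rpower_Ropp.
           apply Rinv_le_contravar; [lra|].
           set (w := Rmax l l' / 2) in *.
           assert (Hw : 0 < w) by (unfold w; lra).
           assert (HR : w = Rpower w th * Rpower w (1 - th)).
           { rewrite <- Rpower_plus. replace (th + (1 - th)) with 1 by ring. symmetry; apply Rpower_1; auto. }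
           assert (Rpower w th <= 1).
           { replace 1 with (Rpower 1 th).
             - apply Rle_Rpower_l; unfold w in *; lra.
             - unfold Rpower; rewrite ln_1, Rmult_0_r; apply exp_0. }
           assert (HP := Rpower_pos w (1 - th)). nra. }
         specialize (HO ltac:(lra)).
         apply Rle_trans with (2 * CB / Rmax l l'); [|lra].
         replace (2 * CB / Rmax l l') with (CB * (2 / Rmax l l')) by (field; lra). nra.
    * intros Hz'. specialize (HO Hz'). assert (HP := Rpower_pos z (th - 1)). nra.
    * intros. exfalso. fold z in H. unfold q in Hpq. lra.
    * intros. exfalso. lra.
Qed.

Lemma pair_correlation g0 g1 g2 t1 c d : strong_phase g0 g1 g2 t1 c d ->
  exists C th, 0 < C /\ 0 < th < 1 /\
  forall b l l' y y' A B, b < 1 -> 0 < l -> 0 < l' -> A <= y -> A <= y' -> y + 1 <= B -> y' + 1 <= B ->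
  exists J, is_RInt (pair_kernel g0 b l l' y y') A B J /\
    correlation_bound C th (Rmax l l') (Rabs (y' - y)) J.
Proof.
intros Hph. destruct (pair_correlation_ordered _ _ _ _ _ _ Hph) as [C [th [HC [Hth H]]]].
exists C, th. split; [auto|split; [auto|]].
intros b l l' y y' A B Hb Hl Hl' HA HA' HB HB'.
destruct (Rle_lt_dec y y') as [Hy|Hy].
- rewrite Rabs_pos_eq by lra. apply H; auto.
- rewrite Rabs_left by lra. replace (- (y' - y)) with (y - y') by ring. rewrite Rmax_comm.
  destruct (H b l' l y' y A B) as [J [HJ HJb]]; try lra.
  exists J. split; auto. apply (is_RInt_ext (pair_kernel g0 b l' l y' y)); auto.
  intros x _. apply pair_kernel_sym.
Qed.

(** * Calderon-Zygmund scales *)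

Fixpoint sumr (f : nat -> R) (N : nat) : R :=
  match N with O => 0 | S n => sumr f n + f n end.

Lemma sumr_ext f g N : (forall n, (n < N)%nat -> f n = g n) -> sumr f N = sumr g N.
Proof. induction N; intros H; simpl; auto. rewrite IHN, H by (auto with arith). auto. Qed.

Lemma sumr_le f g N : (forall n, (n < N)%nat -> f n <= g n) -> sumr f N <= sumr g N.
Proof. induction N; intros H; simpl; [lra|]. apply Rplus_le_compat; auto with arith. Qed.

Lemma sumr_zero f N : (forall n, (n < N)%nat -> f n = 0) -> sumr f N = 0.
Proof. induction N; intros H; simpl; auto. rewrite IHN, H by (auto with arith). ring. Qed.

Lemma sumr_nonneg f N : (forall n, (n < N)%nat -> 0 <= f n) -> 0 <= sumr f N.
Proof. induction N; intros H; simpl; [lra|]. apply Rplus_le_le_0_compat; auto with arith. Qed.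

Lemma sumr_plus f g N : sumr (fun n => f n + g n) N = sumr f N + sumr g N.
Proof. induction N; simpl; [ring|]. rewrite IHN; ring. Qed.

Lemma sumr_scal k f N : sumr (fun n => k * f n) N = k * sumr f N.
Proof. induction N; simpl; [ring|]. rewrite IHN; ring. Qed.

Lemma sumr_app f N M : sumr f (N + M) = sumr f N + sumr (fun n => f (N + n)%nat) M.
Proof.
induction M; simpl.
- rewrite Nat.add_0_r; ring.
- rewrite Nat.add_succ_r. simpl. rewrite IHM. ring.
Qed.

Lemma sumr_swap f N M :
  sumr (fun i => sumr (fun j => f i j) M) N = sumr (fun j => sumr (fun i => f i j) N) M.
Proof.
induction N; simpl.
- symmetry; apply sumr_zero; auto.
- rewrite IHN, <- sumr_plus. auto.
Qed.

Lemma sumr_mult f g N M : sumr f N * sumr g M = sumr (fun i => sumr (fun j => f i * g j) M) N.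
Proof.
induction N; simpl; [ring|]. rewrite <- IHN, sumr_scal. ring.
Qed.

Lemma is_RInt_sumr (f : nat -> R -> R) I N a b :
  (forall n, (n < N)%nat -> is_RInt (f n) a b (I n)) ->
  is_RInt (fun x => sumr (fun n => f n x) N) a b (sumr I N).
Proof.
induction N; intros H; simpl.
- apply is_RInt_vanishing; auto.
- apply (is_RInt_plus (fun x => sumr (fun n => f n x) N) (f N)); auto with arith.
Qed.

Definition covered (E : list (R * R)) (x : R) : Prop :=
  Exists (fun I => fst I < x < snd I) E.

Definition total (E : list (R * R)) : R := List.fold_right (fun (J : R * R) (s : R) => (snd J - fst J) + s) 0 E.

Definition intervals (E : list (R * R)) : Prop := List.Forall (fun I => fst I <= snd I) E.

Lemma covered_app E F x : covered (E ++ F) x <-> covered E x \/ covered F x.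
Proof. apply Exists_app. Qed.

Lemma total_app E F : total (E ++ F) = total E + total F.
Proof. induction E; simpl; [ring|]. rewrite IHE; ring. Qed.

(** Length of the intersection of [P,Q] and [a,b]. Bounds by this length add up over the two halves
    of a block ([overlap_split]); bounds by Q - P would double at each level. *)
Definition overlap (P Q a b : R) : R := Rmax 0 (Rmin Q b - Rmax P a).

Ltac overlap_cases :=
  unfold overlap, Rmax, Rmin;
  repeat match goal with
  | |- context [Rle_dec ?x ?y] =>
      lazymatch x with context [Rle_dec _ _] => fail | _ =>
      lazymatch y with context [Rle_dec _ _] => fail | _ =>
      destruct (Rle_dec x y) end end
  end; lra.

Lemma overlap_split P Q a m b : a <= m <= b -> overlap P Q a m + overlap P Q m b <= overlap P Q a b.
Proof.
intros H. overlap_cases.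
Qed.

Lemma overlap_le P Q a b : P <= Q -> overlap P Q a b <= Q - P.
Proof.
intros H. overlap_cases.
Qed.

Lemma overlap_pos P Q a b : 0 <= overlap P Q a b.
Proof. apply Rmax_l. Qed.

Lemma overlap_full P Q a b : P <= a -> b <= Q -> b - a <= overlap P Q a b.
Proof.
intros H1 H2. overlap_cases.
Qed.

Definition window (y c ell : nat -> R) (A B r : R) (n : nat) : R :=
  if Rle_dec A (y n) then if Rle_dec (y n) B then if Rle_dec (ell n) r then c n else 0 else 0 else 0.

Lemma window_le y c ell A B r n : 0 <= c n -> window y c ell A B r n <= c n.
Proof.
intros H. unfold window.
destruct (Rle_dec A (y n)), (Rle_dec (y n) B), (Rle_dec (ell n) r); lra.
Qed.

Definition node (y0 h : R) (n : nat) : R := y0 + INR n * h.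

(** If some point of the block lies in [A,B] and the block has length at most r, the whole block
    lies in [A-r, B+r] and the overlap is its full length; otherwise the window is empty. *)
Lemma constant_scale_window h al y0 c N ell A B r :
  0 < h -> 0 < al -> (forall n, 0 <= c n) -> sumr c N <= 2 * al * (INR N * h) ->
  (forall n, (n < N)%nat -> ell n = INR N * h) ->
  sumr (window (node y0 h) c ell A B r) N <= 2 * al * overlap (A - r) (B + r) y0 (y0 + INR N * h).
Proof.
intros Hh Hal Hc HS Hell.
destruct (classic (exists n, (n < N)%nat /\ A <= node y0 h n <= B /\ ell n <= r)) as [[n [Hn [HAB Hr]]]|Hno].
- rewrite Hell in Hr by auto. unfold node in HAB.
  assert (Hn1 : 0 <= INR n) by apply pos_INR.
  assert (Hn2 : INR n <= INR N) by (apply le_INR; lia).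
  assert (HO : y0 + INR N * h - y0 <= overlap (A - r) (B + r) y0 (y0 + INR N * h)).
  { apply overlap_full; nra. }
  apply Rle_trans with (sumr c N).
  + apply sumr_le; intros; apply window_le; auto.
  + eapply Rle_trans; [apply HS|]. apply Rmult_le_compat_l; lra.
- rewrite sumr_zero.
  + apply Rmult_le_pos; [lra|apply overlap_pos].
  + intros n Hn. unfold window.
    destruct (Rle_dec A (node y0 h n)); auto. destruct (Rle_dec (node y0 h n) B); auto.
    destruct (Rle_dec (ell n) r); auto. exfalso; apply Hno; exists n; auto.
Qed.

(* Calderon-Zygmund stopping time: ell n is the length of the maximal dyadic block
   containing n whose mass exceeds al times its length, and h if there is none. *)
Lemma calderon_zygmund_scales h al : 0 < h -> 0 < al ->
  forall m (c : nat -> R) y0, (forall n, 0 <= c n) ->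
  sumr c (2 ^ m) <= 2 * al * (INR (2 ^ m) * h) ->
  exists (ell : nat -> R) (E : list (R * R)),
    (forall n, h <= ell n) /\ intervals E /\ total E <= 2 / al * sumr c (2 ^ m) /\
    (forall n x, (n < 2 ^ m)%nat -> 0 < x - node y0 h n <= ell n -> h < ell n -> covered E x) /\
    (forall A B r, sumr (window (node y0 h) c ell A B r) (2 ^ m) <=
       2 * al * overlap (A - r) (B + r) y0 (y0 + INR (2 ^ m) * h)).
Proof.
intros Hh Hal. induction m as [|m IH]; intros c y0 Hc HS.
(* A single cell keeps the scale h and needs no interval: h will not exceed the truncation [ep]. *)
- exists (fun _ => h), nil. split; [intros; lra|]. split; [constructor|]. split; [|split].
  + simpl. assert (0 < 2 / al) by (apply Rdiv_lt_0_compat; lra). specialize (Hc O). nra.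
  + intros; lra.
  + intros A B r. apply constant_scale_window; auto. intros; simpl; ring.
- set (N := (2 ^ m)%nat) in *.
  assert (HN2 : (2 ^ S m = N + N)%nat) by (unfold N; simpl; lia).
  assert (HNp : 1 <= INR N) by (apply (le_INR 1); assert (2 ^ m <> 0)%nat by (apply Nat.pow_nonzero; lia); unfold N; lia).
  rewrite HN2 in *. rewrite plus_INR in *.
  destruct (Rlt_le_dec (al * ((INR N + INR N) * h)) (sumr c (N + N))) as [Hbig|Hsmall].
  (* The block is doubled to the right only, since a mass at y acts on x > y. As n + 1 <= N + N,
     such x lie strictly inside. *)
  + exists (fun _ => INR (N + N) * h), ((y0, y0 + 2 * ((INR N + INR N) * h)) :: nil).
    rewrite plus_INR.
    split; [intros; nra|]. split; [constructor; [simpl; nra|constructor]|]. split; [|split].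
    * simpl. apply (Rmult_le_reg_l al); [lra|].
      replace (al * (2 / al * sumr c (N + N))) with (2 * sumr c (N + N)) by (field; lra). lra.
    * intros n x Hn Hx _. constructor. simpl. unfold node in Hx.
      assert (0 <= INR n) by apply pos_INR.
      assert (INR n <= INR N + INR N) by (rewrite <- plus_INR; apply le_INR; lia).
      assert (INR n + 1 <= INR N + INR N) by (rewrite <- plus_INR, <- S_INR; apply le_INR; lia).
      nra.
    * intros A B r. rewrite <- plus_INR. apply constant_scale_window; auto.
      -- rewrite plus_INR; auto.
      -- intros; rewrite ?plus_INR; auto.
  (* A block that does not stop has mass at most al times its length, that is 2 al times the length
     of either half: the hypothesis passes to both halves. *)
  + assert (Hsp := sumr_app c N N).
    assert (P1 : 0 <= sumr c N) by (apply sumr_nonneg; auto).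
    assert (P2 : 0 <= sumr (fun n => c (N + n)%nat) N) by (apply sumr_nonneg; auto).
    destruct (IH c y0) as (e1 & E1 & A1 & B1 & C1 & D1 & F1); [auto|lra|].
    destruct (IH (fun n => c (N + n)%nat) (y0 + INR N * h)) as (e2 & E2 & A2 & B2 & C2 & D2 & F2); [auto|lra|].
    assert (Hnode : forall n, node (y0 + INR N * h) h n = node y0 h (N + n)).
    { intros n. unfold node. rewrite plus_INR; ring. }
    exists (fun n => if lt_dec n N then e1 n else e2 (n - N)%nat), (E1 ++ E2).
    split; [|split; [|split; [|split]]].
    * intros n. destruct (lt_dec n N); auto.
    * apply Forall_app; auto.
    * rewrite total_app, Hsp. lra.
    * intros n x Hn Hx He. apply covered_app.
      destruct (lt_dec n N) as [Hl|Hl].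
      -- left. apply (D1 n); auto.
      -- right. apply (D2 (n - N)%nat); auto; [lia|].
         rewrite Hnode. replace (N + (n - N))%nat with n by lia. auto.
    * intros A B r. rewrite sumr_app.
      apply Rle_trans with (2 * al * overlap (A - r) (B + r) y0 (y0 + INR N * h) +
        2 * al * overlap (A - r) (B + r) (y0 + INR N * h) (y0 + (INR N + INR N) * h)).
      -- apply Rplus_le_compat.
         ++ eapply Rle_trans; [|apply F1]. apply Req_le. apply sumr_ext.
            intros n Hn. unfold window. destruct (lt_dec n N); [auto|lia].
         ++ replace (y0 + (INR N + INR N) * h) with (y0 + INR N * h + INR N * h) by ring.
            eapply Rle_trans; [|apply F2]. apply Req_le. apply sumr_ext.
            intros n Hn. unfold window. rewrite Hnode. destruct (lt_dec (N + n) N); [lia|].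
            replace (N + n - N)%nat with n by lia. auto.
      -- rewrite <- Rmult_plus_distr_l. apply Rmult_le_compat_l; [lra|].
         apply overlap_split. nra.
Qed.

(** * The square function bound *)

Definition ball_mass (z m : nat -> R) (rho : R) (n : nat) : R :=
  if Rle_dec (z n) rho then m n else 0.

(** Halving rho splits off the shell rho/2 < z <= rho, of mass at most 2 K rho and weight at most C
    (rho/2)^(th-1); the shells form a geometric series because th > 0. Once rho <= r the bound C/r
    takes over. *)
Lemma weighted_mass_dyadic C K th r N (z m B : nat -> R) :
  0 < C -> 0 < K -> 0 < th < 1 -> 0 < r ->
  (forall n, 0 <= z n) -> (forall n, 0 <= m n) ->
  (forall rho, 0 <= rho -> sumr (ball_mass z m rho) N <= K * (rho + r)) ->
  (forall n, 0 <= B n <= C / r) ->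
  (forall n, 0 < z n -> B n <= C * Rpower (z n) (th - 1)) ->
  forall k rho, 0 < rho <= 2 ^ k * r ->
  sumr (fun n => ball_mass z m rho n * B n) N <=
    C * K * (2 + 4 / (Rpower 2 th - 1) * Rpower rho th).
Proof.
intros HC HK Hth Hr Hz Hm Hmass HB0 HB1.
assert (H2 : 1 < Rpower 2 th).
{ replace 1 with (Rpower 2 0) by (apply Rpower_O; lra). apply Rpower_lt; lra. }
(* Solves D + 4 = D 2^th, the recursion from rho/2 to rho. *)
set (D := 4 / (Rpower 2 th - 1)).
assert (HD : 0 < D) by (apply Rdiv_lt_0_compat; lra).
assert (HCK : 0 < C * K) by nra.
assert (Hball : forall rho n, 0 <= ball_mass z m rho n).
{ intros rho n. unfold ball_mass. destruct (Rle_dec (z n) rho); auto; lra. }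
assert (Hbase : forall rho, 0 < rho <= r ->
  sumr (fun n => ball_mass z m rho n * B n) N <= C * K * (2 + D * Rpower rho th)).
{ intros rho Hrho.
  assert (HP := Rpower_pos rho th).
  apply Rle_trans with (C / r * sumr (ball_mass z m rho) N).
  - rewrite <- sumr_scal. apply sumr_le. intros n _. rewrite Rmult_comm.
    apply Rmult_le_compat_r; [auto|apply HB0].
  - apply Rle_trans with (C / r * (K * (2 * r))).
    + apply Rmult_le_compat_l; [left; apply Rdiv_lt_0_compat; lra|].
      eapply Rle_trans; [apply Hmass; lra|]. apply Rmult_le_compat_l; lra.
    + replace (C / r * (K * (2 * r))) with (C * K * 2) by (field; lra).
      apply Rmult_le_compat_l; [lra|]. assert (0 < D * Rpower rho th) by nra. lra. }
induction k as [|k IH]; intros rho Hrho.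
- apply Hbase. simpl in Hrho; lra.
- destruct (Rle_lt_dec rho r) as [Hle|Hgt]; [apply Hbase; lra|].
  assert (HP := Rpower_pos (rho / 2) th).
  assert (Hhalf : Rpower rho th = Rpower 2 th * Rpower (rho / 2) th).
  { rewrite <- Rpower_base_mult by lra. f_equal; field. }
  assert (IH' := IH (rho / 2)). simpl in Hrho. specialize (IH' ltac:(lra)).
  apply Rle_trans with
    (sumr (fun n => ball_mass z m (rho / 2) n * B n) N +
     C * Rpower (rho / 2) (th - 1) * sumr (ball_mass z m rho) N).
  + rewrite <- sumr_scal, <- sumr_plus. apply sumr_le. intros n _.
    unfold ball_mass. specialize (Hm n). specialize (HB0 n).
    assert (HQ := Rpower_pos (rho / 2) (th - 1)).
    assert (0 <= C * Rpower (rho / 2) (th - 1) * m n) by (apply Rmult_le_pos; nra).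
    destruct (Rle_dec (z n) rho), (Rle_dec (z n) (rho / 2)); try lra.
    rewrite Rmult_0_l, Rplus_0_l, Rmult_comm. apply Rmult_le_compat_r; [auto|].
    eapply Rle_trans; [apply HB1; lra|]. apply Rmult_le_compat_l; [lra|].
    apply Rpower_neg_le; lra.
  + apply Rle_trans with (C * K * (2 + D * Rpower (rho / 2) th) + C * K * (4 * Rpower (rho / 2) th)).
    * apply Rplus_le_compat; [auto|].
      assert (HE : rho / 2 * Rpower (rho / 2) (th - 1) = Rpower (rho / 2) th).
      { rewrite <- (Rpower_1 (rho / 2)) at 1 by lra. rewrite <- Rpower_plus. f_equal; ring. }
      assert (HQ := Rpower_pos (rho / 2) (th - 1)).
      apply Rle_trans with (C * Rpower (rho / 2) (th - 1) * (K * (2 * rho))).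
      -- apply Rmult_le_compat_l; [nra|]. eapply Rle_trans; [apply Hmass; lra|].
         apply Rmult_le_compat_l; lra.
      -- rewrite <- HE. apply Req_le. field.
    * rewrite <- Rmult_plus_distr_l. apply Rmult_le_compat_l; [lra|]. rewrite Hhalf.
      apply Req_le. unfold D. field. lra.
Qed.

(** The weights vanish from distance 1 on, so rho = 1 captures everything. The result no longer
    depends on r, which makes the row sums below uniform. *)
Lemma weighted_mass_bound C K th r N (z m B : nat -> R) :
  0 < C -> 0 < K -> 0 < th < 1 -> 0 < r ->
  (forall n, 0 <= z n) -> (forall n, 0 <= m n) ->
  (forall rho, 0 <= rho -> sumr (ball_mass z m rho) N <= K * (rho + r)) ->
  (forall n, 0 <= B n <= C / r) ->
  (forall n, 0 < z n -> B n <= C * Rpower (z n) (th - 1)) ->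
  (forall n, 1 <= z n -> B n = 0) ->
  sumr (fun n => m n * B n) N <= C * K * (2 + 4 / (Rpower 2 th - 1)).
Proof.
intros HC HK Hth Hr Hz Hm Hmass HB0 HB1 HB2.
destruct (Pow_x_infinity 2) with (b := / r) as [k Hk].
{ rewrite Rabs_pos_eq; lra. }
specialize (Hk k (le_n k)). rewrite Rabs_pos_eq in Hk by (apply pow_le; lra).
apply Rge_le in Hk. apply (Rmult_le_compat_r r) in Hk; [|lra]. rewrite Rinv_l in Hk by lra.
assert (H := weighted_mass_dyadic C K th r N z m B HC HK Hth Hr Hz Hm Hmass HB0 HB1 k 1 ltac:(lra)).
replace (Rpower 1 th) with 1 in H by (unfold Rpower; rewrite ln_1, Rmult_0_r, exp_0; auto).
rewrite Rmult_1_r in H. eapply Rle_trans; [|apply H].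
apply sumr_le. intros n _. unfold ball_mass. destruct (Rle_dec (z n) 1) as [|Hn]; [lra|].
rewrite HB2 by lra. lra.
Qed.

Definition Fcos g0 ep b (y c ell : nat -> R) N x :=
  sumr (fun n => c n * kcos g0 (Rmax ep (ell n)) b (x - y n)) N.
Definition Fsin g0 ep b (y c ell : nat -> R) N x :=
  sumr (fun n => c n * ksin g0 (Rmax ep (ell n)) b (x - y n)) N.

(** The square expands into pair correlations, and each pair is charged to its member of larger
    cutoff L. Within distance rho of that member the masses of cutoff at most L add up to O(al (rho
    + L)), and the correlation is controlled by the same L, so every row sums to O(al). *)
Lemma square_sum_bound g0 g1 g2 t1 c0 d : strong_phase g0 g1 g2 t1 c0 d ->
  exists K, 0 < K /\ forall b ep al y c ell N A B,
  b < 1 -> 0 < ep -> 0 < al ->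
  (forall n, (n < N)%nat -> A <= y n /\ y n + 1 <= B) ->
  (forall A B r, A <= B -> 0 <= r ->
     sumr (window y (fun n => Rabs (c n)) ell A B r) N <= 2 * al * (B - A + 2 * r)) ->
  exists I, is_RInt (fun x => Fcos g0 ep b y c ell N x ^ 2 + Fsin g0 ep b y c ell N x ^ 2) A B I /\
    I <= K * al * sumr (fun n => Rabs (c n)) N.
Proof.
intros Hph. destruct (pair_correlation _ _ _ _ _ _ Hph) as [C [th [HC [Hth HJ]]]].
assert (H2 : 1 < Rpower 2 th).
{ replace 1 with (Rpower 2 0) by (apply Rpower_O; lra). apply Rpower_lt; lra. }
assert (HD : 0 < 4 / (Rpower 2 th - 1)) by (apply Rdiv_lt_0_compat; lra).
(* The 4 comes from the window of radius rho about a point: 2 al (2 rho + 2 L) = 4 al (rho + L). *)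
set (K := C * 4 * (2 + 4 / (Rpower 2 th - 1))).
assert (HK : 0 < K) by (unfold K; nra).
exists (2 * K). split; [lra|].
intros b ep al y c ell N A B Hb Hep Hal HAB Hw.
set (L := fun n => Rmax ep (ell n)).
assert (HL : forall n, 0 < L n) by (intros n; assert (ep <= L n) by apply Rmax_l; lra).
set (J := fun i j => RInt (pair_kernel g0 b (L i) (L j) (y i) (y j)) A B).
assert (HJJ : forall i j, (i < N)%nat -> (j < N)%nat ->
  is_RInt (pair_kernel g0 b (L i) (L j) (y i) (y j)) A B (J i j) /\
  correlation_bound C th (Rmax (L i) (L j)) (Rabs (y j - y i)) (J i j)).
{ intros i j Hi Hj. destruct (HAB i Hi), (HAB j Hj).
  destruct (HJ b (L i) (L j) (y i) (y j) A B) as [J0 [E1 E2]]; auto.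
  unfold J. rewrite (is_RInt_unique _ _ _ _ E1). auto. }
exists (sumr (fun i => sumr (fun j => c i * c j * J i j) N) N). split.
{ apply (is_RInt_ext (fun x => sumr (fun i => sumr (fun j => c i * c j * pair_kernel g0 b (L i) (L j) (y i) (y j) x) N) N)).
  - intros x _. unfold Fcos, Fsin. rewrite <- !Rsqr_pow2. unfold Rsqr. rewrite !sumr_mult, <- sumr_plus.
    apply sumr_ext; intros i _. rewrite <- sumr_plus. apply sumr_ext; intros j _.
    unfold pair_kernel, L. ring.
  - apply is_RInt_sumr. intros i Hi. apply is_RInt_sumr. intros j Hj.
    apply (is_RInt_scal (pair_kernel g0 b (L i) (L j) (y i) (y j))). apply HJJ; auto. }
set (T := fun i j => if Rle_dec (L j) (L i) then Rabs (c j) * Rabs (J i j) else 0).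
assert (HT : forall i j, 0 <= T i j).
{ intros i j. unfold T. destruct (Rle_dec (L j) (L i)); [|lra]. apply Rmult_le_pos; apply Rabs_pos. }
assert (Hrow : forall i, (i < N)%nat -> sumr (T i) N <= K * al).
{ intros i Hi.
  set (z := fun n => Rabs (y n - y i)).
  set (m := fun n => if Rle_dec (L n) (L i) then Rabs (c n) else 0).
  (* [weighted_mass_bound] asks for its estimates at every index, hence the value 0 from N on. *)
  set (Bd := fun n => if lt_dec n N then if Rle_dec (L n) (L i) then Rabs (J i n) else 0 else 0).
  assert (HBd : forall n, Bd n = 0 \/ (Bd n = Rabs (J i n) /\ correlation_bound C th (L i) (z n) (J i n))).
  { intros n. unfold Bd. destruct (lt_dec n N) as [Hn|]; [|auto].
    destruct (Rle_dec (L n) (L i)) as [Hln|]; [|auto]. right. split; auto.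
    destruct (HJJ i n Hi Hn) as [_ H]. rewrite Rmax_left in H by auto. exact H. }
  apply Rle_trans with (sumr (fun n => m n * Bd n) N).
  { apply sumr_le. intros n Hn. unfold T, m, Bd. destruct (lt_dec n N); [|lia].
    destruct (Rle_dec (L n) (L i)); lra. }
  replace (K * al) with (C * (4 * al) * (2 + 4 / (Rpower 2 th - 1))) by (unfold K; ring).
  apply (weighted_mass_bound C (4 * al) th (L i) N z m Bd); auto.
  - lra.
  - intros; apply Rabs_pos.
  - intros n. unfold m. destruct (Rle_dec (L n) (L i)); [apply Rabs_pos|lra].
  - intros rho Hrho.
    apply Rle_trans with (2 * al * (y i + rho - (y i - rho) + 2 * L i)).
    + eapply Rle_trans; [|apply Hw; [lra|left; apply HL]].
      apply sumr_le. intros n _. unfold ball_mass, window, m, z.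
      assert (Hc := Rabs_pos (c n)).
      destruct (Rle_dec (Rabs (y n - y i)) rho) as [H1|H1].
      * apply Rabs_le_between in H1.
        destruct (Rle_dec (y i - rho) (y n)); [|lra].
        destruct (Rle_dec (y n) (y i + rho)); [|lra].
        destruct (Rle_dec (L n) (L i)) as [H3|H3], (Rle_dec (ell n) (L i)) as [H4|H4]; try lra.
        exfalso. assert (ell n <= L n) by apply Rmax_r. lra.
      * destruct (Rle_dec (y i - rho) (y n)); [|lra].
        destruct (Rle_dec (y n) (y i + rho)); [|lra].
        destruct (Rle_dec (ell n) (L i)); lra.
    + apply Req_le; ring.
  - intros n. assert (0 <= C / L i) by (left; apply Rdiv_lt_0_compat; auto).
    destruct (HBd n) as [->|[-> [H1 _]]]; [lra|]. split; [apply Rabs_pos|auto].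
  - intros n Hz. destruct (HBd n) as [->|[-> [_ [H1 _]]]]; auto.
    apply Rmult_le_pos; [lra|left; apply Rpower_pos].
  - intros n Hz. destruct (HBd n) as [->|[-> [_ [_ [H1 _]]]]]; auto.
    rewrite H1 by auto. apply Rabs_R0. }
assert (Hsymm : forall i j, Rabs (J i j) = Rabs (J j i)).
{ intros i j. f_equal. unfold J. apply RInt_ext. intros; apply pair_kernel_sym. }
apply Rle_trans with (sumr (fun i => sumr (fun j => Rabs (c i) * T i j + Rabs (c j) * T j i) N) N).
- apply sumr_le. intros i _. apply sumr_le. intros j _.
  apply Rle_trans with (Rabs (c i) * Rabs (c j) * Rabs (J i j)).
  { rewrite <- !Rabs_mult. apply Rle_abs. }
  assert (Hi := Rabs_pos (c i)). assert (Hj := Rabs_pos (c j)).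
  assert (HTi := HT i j). assert (HTj := HT j i).
  assert (0 <= Rabs (c i) * T i j) by (apply Rmult_le_pos; auto).
  assert (0 <= Rabs (c j) * T j i) by (apply Rmult_le_pos; auto).
  destruct (Rle_dec (L j) (L i)) as [Hl|Hl].
  + apply Rle_trans with (Rabs (c i) * T i j); [|lra].
    unfold T. destruct (Rle_dec (L j) (L i)); [|lra]. lra.
  + apply Rle_trans with (Rabs (c j) * T j i); [|lra].
    unfold T. destruct (Rle_dec (L i) (L j)); [|lra]. rewrite (Hsymm j i). lra.
- assert (HS1 : sumr (fun i => sumr (fun j => Rabs (c i) * T i j) N) N <= K * al * sumr (fun n => Rabs (c n)) N).
  { rewrite <- sumr_scal. apply sumr_le. intros i Hi. rewrite sumr_scal, Rmult_comm.
    apply Rmult_le_compat_r; [apply Rabs_pos|auto]. }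
  rewrite (sumr_ext _ (fun i => sumr (fun j => Rabs (c i) * T i j) N + sumr (fun j => Rabs (c j) * T j i) N)).
  2:{ intros; apply sumr_plus. }
  rewrite sumr_plus. rewrite (sumr_swap (fun i j => Rabs (c j) * T j i)). lra.
Qed.

(** * Chebyshev's inequality *)

(* Each cell meeting the superlevel set is tagged by a point of that set, so that it
   contributes at least lam w to the Riemann sum. *)
Lemma tagged_superlevel_cover G lam w : (forall x, 0 <= G x) -> 0 < lam -> 0 < w ->
  forall n a, exists ptd E,
    pointed_subdiv ptd /\ SF_h ptd = a /\ seq.last (SF_h ptd) (SF_lx ptd) = a + INR n * w /\
    seq_step (SF_lx ptd) <= w /\ intervals E /\ lam * total E <= 3 * Riemann_sum G ptd /\
    (forall x, a <= x < a + INR n * w -> lam < G x -> covered E x).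
Proof.
intros HG Hlam Hw. induction n as [|n IH]; intros a.
- exists (SF_nil a), nil. split; [|split; [|split; [|split; [|split; [|split]]]]].
  + intros i Hi. unfold SF_size in Hi; simpl in Hi. lia.
  + reflexivity.
  + simpl; ring.
  + unfold seq_step; simpl; lra.
  + constructor.
  + unfold Riemann_sum; simpl. unfold zero; simpl. lra.
  + simpl. intros; lra.
- destruct (IH (a + w)) as (ptd & E & H1 & H2 & H3 & H4 & H5 & H6 & H7).
  assert (Hcons : forall tag, a <= tag <= a + w ->
    pointed_subdiv (SF_cons (a, tag) ptd) /\ SF_h (SF_cons (a, tag) ptd) = a /\
    seq.last (SF_h (SF_cons (a, tag) ptd)) (SF_lx (SF_cons (a, tag) ptd)) = a + INR (S n) * w /\
    seq_step (SF_lx (SF_cons (a, tag) ptd)) <= w /\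
    Riemann_sum G (SF_cons (a, tag) ptd) = w * G tag + Riemann_sum G ptd).
  { intros tag Htag. split; [|split; [|split; [|split]]].
    - intros [|i] Hi; rewrite SF_lx_cons, SF_ly_cons.
      + unfold SF_lx; simpl. rewrite H2. lra.
      + apply H1. unfold SF_size in *; simpl in *. lia.
    - reflexivity.
    - rewrite SF_lx_cons. simpl fst. simpl SF_h.
      replace (a + INR (S n) * w) with (a + w + INR n * w) by (rewrite S_INR; ring).
      rewrite <- H3. reflexivity.
    - rewrite SF_lx_cons. simpl fst.
      change (Rmax (Rabs (SF_h ptd - a)) (seq_step (SF_lx ptd)) <= w).
      rewrite H2. replace (a + w - a) with w by ring. rewrite Rabs_pos_eq by lra.
      apply Rmax_lub; lra.
    - rewrite Riemann_sum_cons, H2. unfold plus, scal; simpl. unfold mult; simpl. ring. }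
  rewrite S_INR.
  destruct (classic (exists x, a <= x <= a + w /\ lam < G x)) as [[x [Hx HGx]]|Hno].
  + destruct (Hcons x Hx) as (A1 & A2 & A3 & A4 & A5).
    (* The cell is widened by w on both sides so that an open interval contains it; this is the
       factor 3. *)
    exists (SF_cons (a, x) ptd), ((a - w, a + 2 * w) :: E).
    rewrite S_INR in A3. rewrite A5. split; [auto|]. split; [auto|]. split; [auto|]. split; [auto|].
    split; [constructor; [simpl; lra|auto]|]. split.
    * simpl. nra.
    * intros y Hy HGy. destruct (Rlt_le_dec y (a + w)).
      -- constructor 1. simpl; lra.
      -- constructor 2. apply H7; auto. lra.
  + destruct (Hcons a ltac:(lra)) as (A1 & A2 & A3 & A4 & A5).
    exists (SF_cons (a, a) ptd), E.
    rewrite S_INR in A3. rewrite A5. split; [auto|]. split; [auto|]. split; [auto|]. split; [auto|].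
    split; [auto|]. split.
    * assert (HGa := HG a). nra.
    * intros y Hy HGy. destruct (Rle_lt_dec y (a + w)).
      -- exfalso. apply Hno. exists y. lra.
      -- apply H7; auto. lra.
Qed.

(** A single Riemann sum within eta of the integral already yields the cover, so measurability of
    the superlevel set never enters. *)
Lemma chebyshev_cover G A B I lam eta :
  (forall x, 0 <= G x) -> A < B -> is_RInt G A B I -> 0 < lam -> 0 < eta ->
  exists E, intervals E /\ lam * total E <= 3 * (I + eta) /\
    (forall x, A <= x < B -> lam < G x -> covered E x).
Proof.
intros HG HAB HI Hlam Heta.
assert (Hloc : locally I (fun y => Rabs (y - I) < eta)) by (exists (mkposreal eta Heta); intros y Hy; exact Hy).
specialize (HI _ Hloc). destruct HI as [del Hdel].
set (k := (B - A) / del). destruct del as [del Hdp]. simpl in *.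
destruct (archimed k) as [Hk _].
assert (Hk0 : 0 < k) by (apply Rdiv_lt_0_compat; lra).
assert (Hup : (0 < up k)%Z) by (apply lt_IZR; lra).
set (n := Z.to_nat (up k)).
assert (Hn : INR n = IZR (up k)) by (unfold n; rewrite INR_IZR_INZ, Z2Nat.id; [auto|lia]).
set (w := (B - A) / INR n).
assert (Hw : 0 < w) by (apply Rdiv_lt_0_compat; lra).
assert (Hwd : w < del).
{ unfold w. apply (Rmult_lt_reg_r (INR n)); [lra|]. replace ((B - A) / INR n * INR n) with (B - A) by (field; lra).
  replace (B - A) with (k * del) by (unfold k; field; lra). nra. }
assert (Hnw : A + INR n * w = B) by (unfold w; field; lra).
destruct (tagged_superlevel_cover G lam w HG Hlam Hw n A) as (ptd & E & H1 & H2 & H3 & H4 & H5 & H6 & H7).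
rewrite Hnw in *. exists E. split; auto. split; auto.
specialize (Hdel ptd ltac:(lra)).
rewrite Rmin_left, Rmax_right in Hdel by lra.
specialize (Hdel (conj H1 (conj H2 H3))).
rewrite sign_eq_1 in Hdel by lra.
change (Rabs (1 * Riemann_sum G ptd - I) < eta) in Hdel.
apply Rabs_def2 in Hdel. lra.
Qed.

(** * Discretization *)

Lemma RInt_cell_error (f : R -> R) y h K : 0 < h -> ex_RInt f y (y + h) ->
  (forall t, y <= t <= y + h -> Rabs (f t - f y) <= K) ->
  Rabs (RInt f y (y + h) - h * f y) <= h * K.
Proof.
intros Hh Hex HK.
replace (RInt f y (y + h) - h * f y) with (RInt (fun t => f t - f y) y (y + h)).
- replace (h * K) with ((y + h - y) * K) by ring.
  apply abs_RInt_le_const; auto; [lra|].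
  apply (ex_RInt_minus f (fun _ => f y)); auto. apply ex_RInt_const.
- rewrite (RInt_minus f (fun _ => f y)); auto; [|apply ex_RInt_const].
  rewrite RInt_const. unfold minus, plus, opp, scal; simpl. unfold mult; simpl. ring.
Qed.

Definition clamp (p h y : R) : R := Rmin (Rmax y (p - h)) (p + h).

Lemma clamp_incr p h y y' : y <= y' -> clamp p h y <= clamp p h y'.
Proof. intros H. unfold clamp. apply Rle_min_compat_r, Rle_max_compat_r; auto. Qed.

Lemma clamp_bound p h y : 0 < h -> p - h <= clamp p h y <= p + h.
Proof.
intros H. unfold clamp. split; [|apply Rmin_r].
apply Rmin_glb; [apply Rmax_r|lra].
Qed.

Lemma clamp_id p h y : p - h <= y <= p + h -> clamp p h y = y.
Proof. intros H. unfold clamp. rewrite Rmax_left, Rmin_left; lra. Qed.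

(* A cell containing a jump p of phi costs 2 M h, and clamp increases by exactly h across it,
   so that the cost of all such cells telescopes. *)
Lemma grid_error_telescoping phi p q L M A h : 0 < h -> 0 <= L -> 0 <= M ->
  (forall y, Rabs (phi y) <= M) ->
  (forall y y', p < y < q -> p < y' < q -> Rabs (phi y' - phi y) <= L * Rabs (y' - y)) ->
  (forall y, y <= p \/ q <= y -> phi y = 0) ->
  forall N, ex_RInt phi A (A + INR N * h) ->
  Rabs (RInt phi A (A + INR N * h) - sumr (fun n => h * phi (node A h n)) N) <=
    INR N * h * (L * h) + 2 * M * ((clamp p h (A + INR N * h) - clamp p h A) + (clamp q h (A + INR N * h) - clamp q h A)).
Proof.
intros Hh HL HM HphiM Hlip Hout. induction N as [|N IH]; intros Hex.
- simpl. rewrite Rmult_0_l, Rplus_0_r, RInt_point. unfold zero; simpl.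
  rewrite Rminus_0_r, Rabs_R0. lra.
- rewrite S_INR in *. set (y := A + INR N * h) in *.
  assert (HN : 0 <= INR N) by apply pos_INR.
  assert (HAy : A <= y) by (unfold y; nra).
  replace (A + (INR N + 1) * h) with (y + h) in * by (unfold y; ring).
  assert (Hex1 : ex_RInt phi A y) by (apply (ex_RInt_Chasles_1 phi A y (y + h)); auto; lra).
  assert (Hex2 : ex_RInt phi y (y + h)) by (apply (ex_RInt_Chasles_2 phi A y (y + h)); auto; lra).
  specialize (IH Hex1). rewrite <- (RInt_Chasles phi A y (y + h)) by auto.
  simpl sumr. change plus with Rplus. change (node A h N) with y.
  assert (Hc1 := clamp_incr p h y (y + h) ltac:(lra)).
  assert (Hc2 := clamp_incr q h y (y + h) ltac:(lra)).
  assert (Hcell : Rabs (RInt phi y (y + h) - h * phi y) <= h * (L * h) +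
    2 * M * ((clamp p h (y + h) - clamp p h y) + (clamp q h (y + h) - clamp q h y))).
  { assert (Hjump : (y <= p <= y + h) \/ (y <= q <= y + h) ->
      h <= (clamp p h (y + h) - clamp p h y) + (clamp q h (y + h) - clamp q h y)).
    { intros [H|H].
      - rewrite (clamp_id p h y), (clamp_id p h (y + h)) by lra. lra.
      - rewrite (clamp_id q h y), (clamp_id q h (y + h)) by lra. lra. }
    assert (H0 : 0 <= (clamp p h (y + h) - clamp p h y) + (clamp q h (y + h) - clamp q h y)) by lra.
    set (T := (clamp p h (y + h) - clamp p h y) + (clamp q h (y + h) - clamp q h y)) in *.
    assert (H1 : 0 <= h * (L * h)) by (apply Rmult_le_pos; nra).
    assert (H2 : 0 <= 2 * M * T) by (apply Rmult_le_pos; lra).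
    destruct (classic ((y <= p <= y + h) \/ (y <= q <= y + h))) as [HJ|HJ].
    - apply Rle_trans with (h * (2 * M)).
      + apply RInt_cell_error; auto. intros t _.
        assert (Ha := HphiM t). assert (Hb := HphiM y).
        apply Rabs_le_between in Ha. apply Rabs_le_between in Hb. apply Rabs_le. lra.
      + specialize (Hjump HJ). assert (2 * M * h <= 2 * M * T) by (apply Rmult_le_compat_l; lra). lra.
    - apply Rle_trans with (h * (L * h)); [|lra].
      apply RInt_cell_error; auto. intros t Ht.
      destruct (Rlt_le_dec p y) as [Hp|Hp]; [destruct (Rlt_le_dec (y + h) q) as [Hq|Hq]|].
      + eapply Rle_trans; [apply Hlip; lra|]. apply Rmult_le_compat_l; auto. rewrite Rabs_pos_eq; lra.
      + assert (q < y) by (apply Rnot_le_lt; intros HH; apply HJ; right; lra).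
        rewrite (Hout t), (Hout y) by lra. rewrite Rminus_0_r, Rabs_R0. nra.
      + assert (y + h < p) by (apply Rnot_le_lt; intros HH; apply HJ; left; lra).
        rewrite (Hout t), (Hout y) by lra. rewrite Rminus_0_r, Rabs_R0. nra. }
  replace (RInt phi A y + RInt phi y (y + h) - (sumr (fun n => h * phi (node A h n)) N + h * phi y))
    with ((RInt phi A y - sumr (fun n => h * phi (node A h n)) N) + (RInt phi y (y + h) - h * phi y)) by ring.
  eapply Rle_trans; [apply Rabs_triang|]. lra.
Qed.

(** Each clamp increases by at most 2 h in total, so the two jumps cost 2 M (4 h) whatever N is. *)
Lemma grid_error phi p q L M A h N : 0 < h -> 0 <= L -> 0 <= M ->
  (forall y, Rabs (phi y) <= M) ->
  (forall y y', p < y < q -> p < y' < q -> Rabs (phi y' - phi y) <= L * Rabs (y' - y)) ->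
  (forall y, y <= p \/ q <= y -> phi y = 0) ->
  ex_RInt phi A (A + INR N * h) ->
  Rabs (RInt phi A (A + INR N * h) - sumr (fun n => h * phi (node A h n)) N) <=
    (L * (INR N * h) + 8 * M) * h.
Proof.
intros Hh HL HM HphiM Hlip Hout Hex.
eapply Rle_trans; [apply (grid_error_telescoping phi p q L M); auto|].
assert (H1 := clamp_bound p h (A + INR N * h) Hh). assert (H2 := clamp_bound p h A Hh).
assert (H3 := clamp_bound q h (A + INR N * h) Hh). assert (H4 := clamp_bound q h A Hh).
set (T := clamp p h (A + INR N * h) - clamp p h A + (clamp q h (A + INR N * h) - clamp q h A)).
assert (T <= 4 * h) by (unfold T; lra).
assert (2 * M * T <= 2 * M * (4 * h)) by (apply Rmult_le_compat_l; lra). lra.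
Qed.

Lemma lipschitz_of_derive f f' a b K :
  (forall t, a <= t <= b -> is_derive f t (f' t)) -> (forall t, a <= t <= b -> Rabs (f' t) <= K) ->
  forall s t, a <= s <= b -> a <= t <= b -> Rabs (f t - f s) <= K * Rabs (t - s).
Proof.
intros Hd HK s t Hs Ht.
destruct (MVT_gen f s t f') as [x [Hx E]].
- intros x Hx. apply Hd. unfold Rmin, Rmax in Hx; destruct (Rle_dec s t); lra.
- intros x Hx. apply continuity_pt_filterlim. apply (is_derive_continuous_R f x (f' x)). apply Hd.
  unfold Rmin, Rmax in Hx; destruct (Rle_dec s t); lra.
- rewrite E, Rabs_mult. apply Rmult_le_compat_r; [apply Rabs_pos|]. apply HK.
  unfold Rmin, Rmax in Hx; destruct (Rle_dec s t); lra.
Qed.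

Definition lipschitz_bounded (w : R -> R) (L M : R) : Prop :=
  (forall x y, Rabs (w y - w x) <= L * Rabs (y - x)) /\ (forall x, Rabs (w x) <= M).

Lemma lipschitz_continuous w L M x : lipschitz_bounded w L M -> continuous w x.
Proof.
intros [HL _]. apply continuity_pt_filterlim. intros e He.
assert (HL1 : 0 < Rabs L + 1) by (assert (H := Rabs_pos L); lra).
exists (e / (Rabs L + 1)). split; [apply Rdiv_lt_0_compat; lra|].
intros y [_ Hy]. unfold dist in *; simpl in *. unfold R_dist in *.
eapply Rle_lt_trans; [apply HL|].
apply Rle_lt_trans with ((Rabs L + 1) * Rabs (y - x)).
- apply Rmult_le_compat_r; [apply Rabs_pos|]. assert (H := Rle_abs L). lra.
- apply (Rmult_lt_compat_l (Rabs L + 1)) in Hy; auto.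
  replace ((Rabs L + 1) * (e / (Rabs L + 1))) with e in Hy by (field; lra). auto.
Qed.

Definition osc_integrand (g0 w : R -> R) (x t : R) : R := cos (g0 t) / t * w (x - t).

Section Discretization.

Context {g0 g1 g2 : R -> R} {t1 c d : R} (Hph : strong_phase g0 g1 g2 t1 c d).

Lemma kernel_derive t : 0 < t < 1 ->
  is_derive (fun t => cos (g0 t) / t) t (- (g1 t * sin (g0 t)) / t - cos (g0 t) / t ^ 2).
Proof.
intros Ht. assert (H := sp_d0 _ _ _ _ _ _ Hph t Ht).
auto_derive.
- split; [exists (g1 t); auto|lra].
- replace (Derive (fun x => g0 x) t) with (g1 t) by (symmetry; apply is_derive_unique, H). field; lra.
Qed.

Lemma kernel_lipschitz ep b : 0 < ep -> b < 1 ->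
  forall s t, ep <= s <= b -> ep <= t <= b ->
  Rabs (cos (g0 t) / t - cos (g0 s) / s) <= (g1 ep / ep + / ep ^ 2) * Rabs (t - s).
Proof.
intros Hep Hb.
apply (lipschitz_of_derive _ (fun t => - (g1 t * sin (g0 t)) / t - cos (g0 t) / t ^ 2)).
- intros t Ht. apply kernel_derive. lra.
- intros t Ht.
  assert (Hg := sp_dec _ _ _ _ _ _ Hph ep t Hep ltac:(lra) ltac:(lra)).
  assert (Hp := sp_pos _ _ _ _ _ _ Hph t ltac:(lra)).
  assert (Hs := SIN_bound (g0 t)). assert (Hc := COS_bound (g0 t)).
  assert (Hi : 0 < / t <= / ep) by (split; [apply Rinv_0_lt_compat|apply Rinv_le_contravar]; lra).
  assert (Hi2 : 0 < / t ^ 2 <= / ep ^ 2).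
  { split; [apply Rinv_0_lt_compat; nra|apply Rinv_le_contravar; nra]. }
  assert (H1 : - g1 ep <= g1 t * sin (g0 t) <= g1 ep) by nra.
  assert (H2 : - (g1 ep * / ep) <= - (g1 t * sin (g0 t)) * / t <= g1 ep * / ep).
  { split; [|]; assert (g1 ep * / t <= g1 ep * / ep) by (apply Rmult_le_compat_l; lra); nra. }
  assert (H3 : - / ep ^ 2 <= cos (g0 t) * / t ^ 2 <= / ep ^ 2) by (split; nra).
  apply Rabs_le. unfold Rdiv. lra.
Qed.

Lemma osc_integrand_continuous w L M x t : lipschitz_bounded w L M -> 0 < t < 1 ->
  continuous (osc_integrand g0 w x) t.
Proof.
intros Hw Ht. apply (continuous_mult (fun t => cos (g0 t) / t) (fun t => w (x - t))).
- eapply is_derive_continuous_R. apply kernel_derive; auto.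
- apply (continuous_comp (fun t => x - t) w).
  + apply (continuous_minus (fun _ => x) (fun t => t)); [apply continuous_const|apply continuous_id].
  + eapply lipschitz_continuous; eauto.
Qed.

Lemma is_RInt_osc_reflected w L M x ep b : lipschitz_bounded w L M -> 0 < ep -> ep < b -> b < 1 ->
  is_RInt (fun y => osc_integrand g0 w x (x - y)) (x - b) (x - ep) (RInt (osc_integrand g0 w x) ep b).
Proof.
intros Hw Hep Hb Hb1. set (J := RInt (osc_integrand g0 w x) ep b).
assert (HJ : is_RInt (osc_integrand g0 w x) ep b J).
{ apply (RInt_correct (osc_integrand g0 w x)). apply (ex_RInt_continuous_on _ 0 1); try lra.
  intros; eapply osc_integrand_continuous; eauto. }
apply (is_RInt_ext (fun y => opp (scal (-1) (osc_integrand g0 w x (-1 * y + x))))).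
- intros y _. unfold opp, scal; simpl. unfold mult; simpl.
  replace (-1 * y + x) with (x - y) by ring. ring.
- rewrite <- (opp_opp J).
  apply (is_RInt_opp (fun y => scal (-1) (osc_integrand g0 w x (-1 * y + x)))).
  apply (is_RInt_comp_lin (osc_integrand g0 w x)).
  replace (-1 * (x - b) + x) with b by ring. replace (-1 * (x - ep) + x) with ep by ring.
  apply (is_RInt_swap (osc_integrand g0 w x)); auto.
Qed.

(** [K] comes before x, so that one step h serves all points. As a function of y the integrand is
    Lipschitz on (x-b, x-ep) and zero outside, the situation of [grid_error]. *)
Lemma osc_discretization w L M ep b : lipschitz_bounded w L M -> 0 < ep -> ep < b -> b < 1 ->
  exists K, 0 <= K /\ forall x A h N, 0 < h -> A <= x - b -> x - ep <= A + INR N * h ->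
  Rabs (RInt (osc_integrand g0 w x) ep b -
     sumr (fun n => h * w (node A h n) * kcos g0 ep b (x - node A h n)) N)
  <= K * (INR N * h + 1) * h.
Proof.
intros Hw Hep Hb Hb1.
set (Lk := g1 ep / ep + / ep ^ 2).
assert (Hg : 0 < g1 ep) by (apply (sp_pos _ _ _ _ _ _ Hph); lra).
assert (HLk : 0 <= Lk).
{ unfold Lk. assert (0 < g1 ep / ep) by (apply Rdiv_lt_0_compat; lra).
  assert (0 < / ep ^ 2) by (apply Rinv_0_lt_compat; nra). lra. }
destruct Hw as [HwL HwM].
assert (HL : 0 <= L).
{ specialize (HwL 0 1). assert (HR := Rabs_pos (w 1 - w 0)). rewrite Rminus_0_r, Rabs_R1 in HwL. lra. }
assert (HM : 0 <= M) by (assert (HR := Rabs_pos (w 0)); specialize (HwM 0); lra).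
assert (Hie : 0 < / ep) by (apply Rinv_0_lt_compat; lra).
assert (HLL : 0 <= L * / ep + M * Lk) by (assert (0 <= L * / ep) by nra; assert (0 <= M * Lk) by nra; lra).
exists ((L * / ep + M * Lk) + 8 * (M * / ep)).
assert (HMe : 0 <= M * / ep) by nra.
split; [lra|].
intros x A h N Hh HA HB.
set (phi := fun y => w y * kcos g0 ep b (x - y)).
assert (Hin : forall y, x - b < y < x - ep -> phi y = osc_integrand g0 w x (x - y)).
{ intros y Hy. unfold phi, kcos, osc_integrand. rewrite trunc_in by lra.
  replace (x - (x - y)) with y by ring. ring. }
assert (Hout : forall y, y <= x - b \/ x - ep <= y -> phi y = 0).
{ intros y Hy. unfold phi, kcos. rewrite trunc_out by lra. ring. }
assert (HJ : is_RInt phi A (A + INR N * h) (RInt (osc_integrand g0 w x) ep b)).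
{ apply (is_RInt_supported _ (fun y => osc_integrand g0 w x (x - y)) A (x - b) (x - ep)); auto; try lra.
  - apply (is_RInt_osc_reflected w L M); auto. split; auto.
  - intros y Hy. apply Hout; lra. }
rewrite <- (is_RInt_unique _ _ _ _ HJ).
rewrite (sumr_ext _ (fun n => h * phi (node A h n))) by (intros; unfold phi; ring).
eapply Rle_trans; [apply (grid_error phi (x - b) (x - ep) (L * / ep + M * Lk) (M * / ep)); auto|].
- intros y. destruct (classic (x - b < y < x - ep)) as [Hy|Hy].
  + rewrite Hin by auto. unfold osc_integrand. rewrite Rabs_mult, Rmult_comm.
    apply Rmult_le_compat; try apply Rabs_pos; auto.
    unfold Rdiv. rewrite Rabs_mult. rewrite (Rabs_pos_eq (/ _)) by (left; apply Rinv_0_lt_compat; lra).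
    assert (Rabs (cos (g0 (x - y))) <= 1) by (apply Rabs_le, COS_bound).
    assert (0 < / (x - y) <= / ep) by (split; [apply Rinv_0_lt_compat|apply Rinv_le_contravar]; lra).
    assert (0 <= Rabs (cos (g0 (x - y)))) by apply Rabs_pos. nra.
  + rewrite Hout by lra. rewrite Rabs_R0. auto.
- intros y y' Hy Hy'. rewrite !Hin by auto. unfold osc_integrand.
  replace (x - (x - y)) with y by ring. replace (x - (x - y')) with y' by ring.
  set (k := cos (g0 (x - y)) / (x - y)). set (k' := cos (g0 (x - y')) / (x - y')).
  assert (Hk : Rabs (k' - k) <= Lk * Rabs (y' - y)).
  { replace (Rabs (y' - y)) with (Rabs ((x - y') - (x - y))).
    - apply (kernel_lipschitz ep b); lra.
    - rewrite <- Rabs_Ropp. f_equal; ring. }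
  assert (Hkb : Rabs k' <= / ep).
  { unfold k', Rdiv. rewrite Rabs_mult. rewrite (Rabs_pos_eq (/ _)) by (left; apply Rinv_0_lt_compat; lra).
    assert (Rabs (cos (g0 (x - y'))) <= 1) by (apply Rabs_le, COS_bound).
    assert (0 < / (x - y') <= / ep) by (split; [apply Rinv_0_lt_compat|apply Rinv_le_contravar]; lra).
    assert (0 <= Rabs (cos (g0 (x - y')))) by apply Rabs_pos. nra. }
  replace (k' * w y' - k * w y) with (k' * (w y' - w y) + w y * (k' - k)) by ring.
  eapply Rle_trans; [apply Rabs_triang|]. rewrite !Rabs_mult.
  assert (H1 := HwL y y'). assert (H2 := HwM y).
  assert (Rabs k' * Rabs (w y' - w y) <= / ep * (L * Rabs (y' - y))) by (apply Rmult_le_compat; auto using Rabs_pos).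
  assert (Rabs (w y) * Rabs (k' - k) <= M * (Lk * Rabs (y' - y))) by (apply Rmult_le_compat; auto using Rabs_pos).
  lra.
- exists (RInt (osc_integrand g0 w x) ep b); auto.
- apply Rmult_le_compat_r; [lra|].
  assert (0 <= INR N * h) by (apply Rmult_le_pos; [apply pos_INR|lra]).
  assert (0 <= 8 * (M * / ep) * (INR N * h)) by nra. lra.
Qed.

End Discretization.

(** * Weak type bound for the truncated operators *)

Lemma cos_quarter_turn x : cos (x - PI / 2) = sin x.
Proof. rewrite <- (cos_shift x), <- cos_neg. f_equal; ring. Qed.

(* Turns the cosine kernel into the sine kernel. *)
Definition quarter (g0 : R -> R) (t : R) : R := g0 t - PI / 2.

Lemma strong_phase_quarter g0 g1 g2 t1 c d :
  strong_phase g0 g1 g2 t1 c d -> strong_phase (quarter g0) g1 g2 t1 c d.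
Proof.
intros H; destruct H; constructor; auto.
intros t Ht. unfold quarter.
replace (g1 t) with (g1 t - 0) by ring.
apply (is_derive_minus g0 (fun _ => PI / 2)); auto. apply (is_derive_const (PI / 2)).
Qed.

Lemma kcos_quarter g0 l b t : kcos (quarter g0) l b t = ksin g0 l b t.
Proof.
unfold kcos, ksin, trunc, quarter. rewrite cos_quarter_turn. auto.
Qed.

Lemma small_dyadic_step W del : 0 < W -> 0 < del -> exists m, 0 < W / INR (2 ^ m) <= del.
Proof.
intros HW Hdel. destruct (Pow_x_infinity 2) with (b := W / del) as [m Hm].
{ rewrite Rabs_pos_eq; lra. }
specialize (Hm m (le_n m)). rewrite Rabs_pos_eq in Hm by (apply pow_le; lra).
exists m. rewrite pow_INR. replace (INR 2) with 2 by (simpl; ring).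
assert (HP : 0 < 2 ^ m) by (apply pow_lt; lra).
split; [apply Rdiv_lt_0_compat; auto|].
apply (Rmult_le_reg_r (2 ^ m)); auto. replace (W / 2 ^ m * 2 ^ m) with W by (field; lra).
apply Rge_le in Hm. apply (Rmult_le_compat_r del) in Hm; [|lra].
replace (W / del * del) with W in Hm by (field; lra). lra.
Qed.

Lemma ex_RInt_lipschitz_abs w L M a b : lipschitz_bounded w L M -> ex_RInt (fun y => Rabs (w y)) a b.
Proof.
intros Hw. apply (ex_RInt_continuous (fun y => Rabs (w y))). intros z _.
apply (continuous_comp w Rabs); [eapply lipschitz_continuous; eauto|apply continuous_Rabs].
Qed.

Lemma grid_mass_error w L M K0 A h N : lipschitz_bounded w L M -> 0 <= K0 ->
  (forall x, K0 <= Rabs x -> w x = 0) -> 0 < h -> A <= - K0 -> K0 <= A + INR N * h ->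
  Rabs (RInt (fun y => Rabs (w y)) (- K0) K0 - sumr (fun n => Rabs (h * w (node A h n))) N)
    <= (L * (INR N * h) + 8 * M) * h.
Proof.
intros Hw HK0 Hsupp Hh HA HB.
assert (Hout : forall y, y <= - K0 \/ K0 <= y -> Rabs (w y) = 0).
{ intros y Hy. rewrite Hsupp; [apply Rabs_R0|]. unfold Rabs; destruct (Rcase_abs y); lra. }
assert (HI : is_RInt (fun y => Rabs (w y)) A (A + INR N * h) (RInt (fun y => Rabs (w y)) (- K0) K0)).
{ apply (is_RInt_supported _ (fun y => Rabs (w y)) A (- K0) K0); auto; try lra.
  - apply (RInt_correct (fun y => Rabs (w y))). eapply ex_RInt_lipschitz_abs; eauto.
  - intros y Hy; apply Hout; lra. }
rewrite <- (is_RInt_unique _ _ _ _ HI).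
rewrite (sumr_ext _ (fun n => h * Rabs (w (node A h n)))).
2:{ intros n _. rewrite Rabs_mult, (Rabs_pos_eq h); lra. }
destruct Hw as [HwL HwM].
apply (grid_error (fun y => Rabs (w y)) (- K0) K0); auto.
- specialize (HwL 0 1). assert (HR := Rabs_pos (w 1 - w 0)). rewrite Rminus_0_r, Rabs_R1 in HwL. lra.
- specialize (HwM 0). assert (HR := Rabs_pos (w 0)). lra.
- intros y. rewrite Rabs_Rabsolu. auto.
- intros y y' _ _. eapply Rle_trans; [apply Rabs_triang_inv2|auto].
- eexists; eauto.
Qed.

Lemma osc_integral_outside_support g0 w K0 x ep b : 0 < ep -> ep < b -> b < 1 ->
  (forall x, K0 <= Rabs x -> w x = 0) -> K0 + 1 < Rabs x -> RInt (osc_integrand g0 w x) ep b = 0.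
Proof.
intros Hep Hb Hb1 Hsupp Hx. apply is_RInt_unique, is_RInt_vanishing.
rewrite Rmin_left, Rmax_right by lra. intros t Ht. unfold osc_integrand.
rewrite Hsupp; [ring|]. unfold Rabs in *. destruct (Rcase_abs x), (Rcase_abs (x - t)); lra.
Qed.

Lemma trunc_raise_cutoff f l l' b t : l <= l' -> ~ (l < t <= l') -> trunc l b f t = trunc l' b f t.
Proof.
intros Hl Ht. unfold trunc. destruct (Rlt_dec l t), (Rlt_dec l' t); auto; lra.
Qed.

(** [K] comes before [ep] and [b], which [weak_type_component] chooses in terms of w and al. *)
Lemma weak_type_truncated g0 g1 g2 t1 c d : strong_phase g0 g1 g2 t1 c d ->
  exists K, 0 < K /\ forall w L M K0 ep b al eta,
  lipschitz_bounded w L M -> 0 <= K0 -> (forall x, K0 <= Rabs x -> w x = 0) ->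
  0 < ep -> ep < b -> b < 1 -> 0 < al -> 0 < eta ->
  exists E, intervals E /\ total E <= K / al * RInt (fun y => Rabs (w y)) (- K0) K0 + eta /\
    forall x, al < Rabs (RInt (osc_integrand g0 w x) ep b) \/
              al < Rabs (RInt (osc_integrand (quarter g0) w x) ep b) -> covered E x.
Proof.
intros Hph. destruct (square_sum_bound _ _ _ _ _ _ Hph) as [K2 [HK2 HL2]].
(* 2 is the doubling of the stopping intervals; 12 = 3 times 4 is the factor of [chebyshev_cover] at
   level (al/2)^2. *)
set (K := 2 + 12 * K2). assert (HK : 0 < K) by (unfold K; lra).
exists K. split; auto.
intros w L M K0 ep b al eta Hw HK0 Hsupp Hep Hb Hb1 Hal Heta.
destruct (osc_discretization Hph w L M ep b Hw Hep Hb Hb1) as [Kc [HKc Hdc]].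
destruct (osc_discretization (strong_phase_quarter _ _ _ _ _ _ Hph) w L M ep b Hw Hep Hb Hb1) as [Ks [HKs Hds]].
set (I1 := RInt (fun y => Rabs (w y)) (- K0) K0).
assert (HI1 : 0 <= I1).
{ unfold I1. apply RInt_ge_0; [lra|eapply ex_RInt_lipschitz_abs; eauto|intros; apply Rabs_pos]. }
assert (HL : 0 <= L /\ 0 <= M).
{ destruct Hw as [H1 H2]. specialize (H1 0 1). specialize (H2 0).
  assert (H3 := Rabs_pos (w 1 - w 0)). assert (H4 := Rabs_pos (w 0)).
  rewrite Rminus_0_r, Rabs_R1 in H1. lra. }
(* The grid covers the support with a margin, and the last term makes it so long that S <= al W, as
   the stopping time requires of the top block. *)
set (W := 2 * K0 + 4 + (I1 + 1) / al).
assert (HW1 : 0 < (I1 + 1) / al) by (apply Rdiv_lt_0_compat; lra).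
assert (HW : 4 < W) by (unfold W; lra).
set (eta1 := Rmin 1 (eta * al / (2 * K))).
assert (Heta1 : 0 < eta1) by (apply Rmin_pos; [lra|apply Rdiv_lt_0_compat; nra]).
assert (Heta1a : eta1 <= 1) by apply Rmin_l.
assert (Heta1b : K / al * eta1 <= eta / 2).
{ assert (H : eta1 <= eta * al / (2 * K)) by apply Rmin_r.
  apply (Rmult_le_compat_l (K / al)) in H; [|left; apply Rdiv_lt_0_compat; lra].
  replace (K / al * (eta * al / (2 * K))) with (eta / 2) in H by (field; lra). auto. }
(* Q1 h <= al keeps both discretization errors below al/2; Q2 h <= eta1 keeps the grid mass S within
   eta1 of I1. *)
set (Q1 := 2 * (Kc + Ks + 1) * (W + 1)). assert (HQ1 : 0 < Q1) by (unfold Q1; nra).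
set (Q2 := L * W + 8 * M + 1). assert (HQ2 : 0 < Q2) by (unfold Q2; assert (0 <= L * W) by nra; lra).
destruct (small_dyadic_step W (Rmin ep (Rmin (al / Q1) (eta1 / Q2)))) as [m Hm]; [lra| |].
{ repeat apply Rmin_pos; auto; apply Rdiv_lt_0_compat; auto. }
set (N := (2 ^ m)%nat) in *. set (h := W / INR N) in *. destruct Hm as [Hh Hm].
assert (Hh1 : h <= ep) by (eapply Rle_trans; [apply Hm|apply Rmin_l]).
assert (Hh2 : h <= al / Q1) by (eapply Rle_trans; [apply Hm|]; eapply Rle_trans; [apply Rmin_r|apply Rmin_l]).
assert (Hh3 : h <= eta1 / Q2) by (eapply Rle_trans; [apply Hm|]; eapply Rle_trans; [apply Rmin_r|apply Rmin_r]).
assert (HN : 0 < INR N).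
{ apply lt_0_INR. assert (N <> 0)%nat by (apply Nat.pow_nonzero; lia). lia. }
assert (HNh : INR N * h = W) by (unfold h; field; lra).
assert (Hh2' : Q1 * h <= al).
{ apply (Rmult_le_compat_l Q1) in Hh2; [|lra]. replace (Q1 * (al / Q1)) with al in Hh2 by (field; lra). auto. }
assert (Hh3' : Q2 * h <= eta1).
{ apply (Rmult_le_compat_l Q2) in Hh3; [|lra]. replace (Q2 * (eta1 / Q2)) with eta1 in Hh3 by (field; lra). auto. }
set (A := - K0 - 2). set (y := node A h). set (cc := fun n => h * w (y n)).
set (S := sumr (fun n => Rabs (cc n)) N).
assert (HS : Rabs (I1 - S) <= eta1).
{ eapply Rle_trans; [apply (grid_mass_error w L M K0 A h N); auto|].
  - unfold A; lra.
  - unfold A, W in *; lra.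
  - rewrite HNh. unfold Q2 in Hh3'. nra. }
apply Rabs_le_between in HS.
assert (HS0 : 0 <= S) by (apply sumr_nonneg; intros; apply Rabs_pos).
assert (HSal : S <= al * W).
{ unfold W. assert (0 <= al * (2 * K0 + 4)) by nra.
  replace (al * (2 * K0 + 4 + (I1 + 1) / al)) with (al * (2 * K0 + 4) + (I1 + 1)) by (field; lra). lra. }
destruct (calderon_zygmund_scales h al Hh Hal m (fun n => Rabs (cc n)) A) as (ell & E1 & Hell & HE1 & HT1 & Hcov1 & Hwin).
{ intros; apply Rabs_pos. }
{ fold N. rewrite HNh. fold S. nra. }
fold N in HT1, Hcov1, Hwin. fold S in HT1.
destruct (HL2 b ep al y cc ell N A (A + W + 1)) as [I2 [HI2 HI2b]]; auto.
{ intros n Hn. unfold y, node. assert (0 <= INR n) by apply pos_INR.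
  assert (INR n <= INR N) by (apply le_INR; lia). assert (INR n * h <= INR N * h) by (apply Rmult_le_compat_r; lra).
  split; nra. }
{ intros A' B' r HAB Hr. eapply Rle_trans; [apply Hwin|].
  apply Rmult_le_compat_l; [lra|]. eapply Rle_trans; [apply overlap_le; lra|]. lra. }
fold S in HI2b.
set (G := fun x => Fcos g0 ep b y cc ell N x ^ 2 + Fsin g0 ep b y cc ell N x ^ 2) in *.
destruct (chebyshev_cover G A (A + W + 1) I2 ((al / 2) ^ 2) (al ^ 2 * eta / 24)) as (E2 & HE2 & HT2 & Hcov2); auto.
{ intros x. unfold G. nra. }
{ lra. }
{ apply pow_lt; lra. }
{ assert (0 < al ^ 2) by (apply pow_lt; lra). nra. }
exists (E1 ++ E2). split; [apply Forall_app; auto|]. split.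
- rewrite total_app.
  assert (HT2' : total E2 <= 12 * K2 / al * S + eta / 2).
  { apply (Rmult_le_reg_l ((al / 2) ^ 2)); [apply pow_lt; lra|].
    eapply Rle_trans; [apply HT2|].
    replace ((al / 2) ^ 2 * (12 * K2 / al * S + eta / 2)) with (3 * (K2 * al * S + al ^ 2 * eta / 24)) by (field; lra).
    lra. }
  assert (K / al * S <= K / al * (I1 + eta1)).
  { apply Rmult_le_compat_l; [left; apply Rdiv_lt_0_compat; lra|lra]. }
  replace (K / al * S) with (2 / al * S + 12 * K2 / al * S) in H by (unfold K; field; lra).
  lra.
- intros x Hx. apply covered_app.
  destruct (classic (covered E1 x)) as [|Hno]; [auto|right].
  (* Farther out the integral vanishes, so the superlevel set lies in the range of the grid. *)
  assert (Hxb : - (K0 + 1) <= x <= K0 + 1).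
  { apply Rabs_le_between. apply Rnot_lt_le. intros Hbig.
    rewrite !(osc_integral_outside_support _ w K0) in Hx by auto. rewrite Rabs_R0 in Hx. lra. }
  (* Off the stopping intervals no mass lies at a distance between [ep] and its own scale, so
     raising the cutoffs to the scales leaves the sum at x unchanged. A scale above [ep] exceeds h
     because h <= ep. *)
  assert (Hcut : forall n, (n < N)%nat -> ~ (ep < x - y n <= Rmax ep (ell n))).
  { intros n Hn Ht. assert (H : x - y n <= ell n).
    { unfold Rmax in Ht. destruct (Rle_dec ep (ell n)); lra. }
    apply Hno. apply (Hcov1 n x); auto; [|lra]. unfold y in *; lra. }
  assert (Hc : sumr (fun n => h * w (node A h n) * kcos g0 ep b (x - node A h n)) N = Fcos g0 ep b y cc ell N x).
  { apply sumr_ext. intros n Hn. unfold cc, y, kcos. f_equal. apply trunc_raise_cutoff; [apply Rmax_l|].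
    apply Hcut; auto. }
  assert (Hs : sumr (fun n => h * w (node A h n) * kcos (quarter g0) ep b (x - node A h n)) N = Fsin g0 ep b y cc ell N x).
  { apply sumr_ext. intros n Hn. unfold cc, y. rewrite kcos_quarter. unfold ksin. f_equal. apply trunc_raise_cutoff; [apply Rmax_l|].
    apply Hcut; auto. }
  assert (Hdc' := Hdc x A h N Hh ltac:(unfold A; lra) ltac:(unfold A, W in *; lra)).
  assert (Hds' := Hds x A h N Hh ltac:(unfold A; lra) ltac:(unfold A, W in *; lra)).
  rewrite Hc, HNh in Hdc'. rewrite Hs, HNh in Hds'.
  assert (Kc * (W + 1) * h <= al / 2 /\ Ks * (W + 1) * h <= al / 2).
  { assert (0 <= Kc * ((W + 1) * h)) by (apply Rmult_le_pos; nra).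
    assert (0 <= Ks * ((W + 1) * h)) by (apply Rmult_le_pos; nra).
    assert (0 <= (W + 1) * h) by nra.
    unfold Q1 in Hh2'. split; lra. }
  apply Hcov2; [unfold A, W in *; lra|]. unfold G.
  assert (Hsq : forall u v : R, Rabs (u - v) <= al / 2 -> al < Rabs u -> (al / 2) ^ 2 < v ^ 2).
  { intros u v H1 H2. assert (Hv : al / 2 < Rabs v).
    { assert (H3 := Rabs_triang (u - v) v). replace (u - v + v) with u in H3 by ring. lra. }
    rewrite <- (pow2_abs v). nra. }
  assert (HFc := pow2_ge_0 (Fcos g0 ep b y cc ell N x)).
  assert (HFs := pow2_ge_0 (Fsin g0 ep b y cc ell N x)).
  destruct Hx as [Hx|Hx].
  + assert (H1 : (al / 2) ^ 2 < Fcos g0 ep b y cc ell N x ^ 2) by (eapply Hsq; [|apply Hx]; lra). lra.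
  + assert (H1 : (al / 2) ^ 2 < Fsin g0 ep b y cc ell N x ^ 2) by (eapply Hsq; [|apply Hx]; lra). lra.
Qed.

(** * The limit of the truncations *)

Lemma Rpower_small K d eta : 0 <= K -> 0 < d -> 0 < eta ->
  exists e0, 0 < e0 /\ forall e, 0 < e <= e0 -> K * Rpower e d <= eta.
Proof.
intros HK Hd He. set (q := eta / (K + 1)). assert (Hq : 0 < q) by (apply Rdiv_lt_0_compat; lra).
exists (Rpower q (/ d)). split; [apply Rpower_pos|]. intros e Hee.
assert (H : Rpower e d <= q).
{ rewrite <- (Rpower_1 q) by auto. replace 1 with (/ d * d) by (field; lra). rewrite <- Rpower_mult.
  apply Rle_Rpower_l; lra. }
assert (HP := Rpower_pos e d).
replace eta with ((K + 1) * q) by (unfold q; field; lra). nra.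
Qed.

Lemma limit_at_zero (T : R -> R) K d t1 : 0 <= K -> 0 < d -> 0 < t1 ->
  (forall e1 e2, 0 < e1 -> e1 <= e2 -> e2 <= t1 -> Rabs (T e1 - T e2) <= K * Rpower e2 d) ->
  exists l, forall e, 0 < e <= t1 -> Rabs (T e - l) <= K * Rpower e d.
Proof.
intros HK Hd Ht1 HT.
set (e := fun n => t1 / (INR n + 1)).
assert (He0 : forall n, 0 < e n <= t1).
{ intros n. assert (0 <= INR n) by apply pos_INR. unfold e. split; [apply Rdiv_lt_0_compat; lra|].
  apply (Rmult_le_reg_r (INR n + 1)); [lra|]. replace (t1 / (INR n + 1) * (INR n + 1)) with t1 by (field; lra). nra. }
assert (Hsmall : forall x, 0 < x -> exists N, forall n, (n >= N)%nat -> e n <= x).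
{ intros x Hx. destruct (archimed (t1 / x)) as [Ha _].
  assert (0 < t1 / x) by (apply Rdiv_lt_0_compat; lra).
  exists (Z.to_nat (up (t1 / x))). intros n Hn.
  assert (Hz : (0 < up (t1 / x))%Z) by (apply lt_IZR; lra).
  apply le_INR in Hn. rewrite INR_IZR_INZ, Z2Nat.id in Hn by lia.
  unfold e. apply (Rmult_le_reg_r (INR n + 1)); [lra|]. replace (t1 / (INR n + 1) * (INR n + 1)) with t1 by (field; lra).
  replace t1 with (x * (t1 / x)) at 1 by (field; lra). apply Rmult_le_compat_l; lra. }
destruct (Rcomplete.R_complete (fun n => T (e n))) as [l Hl].
{ intros eta Heta. destruct (Rpower_small K d (eta / 2) HK Hd ltac:(lra)) as [x [Hx Hxe]].
  destruct (Hsmall x Hx) as [N HN]. exists N. intros n m Hn Hm. unfold R_dist.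
  destruct (Rle_lt_dec (e n) (e m)) as [Hnm|Hnm].
  - eapply Rle_lt_trans; [apply HT; try apply He0; auto|].
    eapply Rle_lt_trans; [apply Hxe; split; [apply He0|apply HN; auto]|]. lra.
  - rewrite Rabs_minus_sym. eapply Rle_lt_trans; [apply HT; try apply He0; lra|].
    eapply Rle_lt_trans; [apply Hxe; split; [apply He0|apply HN; auto]|]. lra. }
exists l. intros x Hx. apply le_epsilon. intros eta Heta.
destruct (Hl eta Heta) as [N1 HN1]. destruct (Hsmall x ltac:(lra)) as [N2 HN2].
set (n := max N1 N2).
specialize (HN1 n ltac:(unfold n; lia)). specialize (HN2 n ltac:(unfold n; lia)). unfold R_dist in HN1.
specialize (HT (e n) x ltac:(apply He0) HN2 ltac:(lra)).
replace (T x - l) with (- (T (e n) - T x) + (T (e n) - l)) by ring.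
eapply Rle_trans; [apply Rabs_triang|]. rewrite Rabs_Ropp. lra.
Qed.

Lemma osc_kernel_bound g0 g1 g2 t1 c d p q : strong_phase g0 g1 g2 t1 c d ->
  0 < p -> p <= q -> q <= t1 ->
  Rabs (RInt (fun t => cos (g0 t) * / t) p q) <= (2 + 4 / d) * / c * Rpower q d.
Proof.
intros Hph Hp Hpq Hq.
assert (Ht1 := sp_t1 _ _ _ _ _ _ Hph). assert (Hc := sp_c _ _ _ _ _ _ Hph).
apply (van_der_corput g0 g1 g2 (fun t => / t) (fun t => - / t ^ 2) 0 1); try lra.
- apply (sp_d _ _ _ _ _ _ Hph).
- intros t Ht. split; [|split].
  + apply (sp_d0 _ _ _ _ _ _ Hph); auto.
  + apply (sp_d1 _ _ _ _ _ _ Hph); auto.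
  + auto_derive; [lra|]. field; lra.
- intros t Ht.
  assert (Hi : 0 < / t) by (apply Rinv_0_lt_compat; lra).
  assert (Hi2 : 0 < / t ^ 2) by (apply Rinv_0_lt_compat; nra).
  repeat split.
  + apply (sp_pos _ _ _ _ _ _ Hph); lra.
  + apply (sp_neg _ _ _ _ _ _ Hph); lra.
  + lra.
  + lra.
  + replace (- - / t ^ 2 * t) with (/ t) by (field; lra). lra.
  + assert (Hg := sp_growth _ _ _ _ _ _ Hph t ltac:(lra)).
    apply (Rmult_le_reg_r (t * c)); [nra|].
    replace (/ t * (t * c)) with c by (field; lra).
    replace (/ c * Rpower t d * g1 t * (t * c)) with (t * g1 t * Rpower t d) by (field; lra). lra.
Qed.

(** Integration by parts moves the derivative to w: with [P] the primitive of the kernel, F(t) -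
    P(t) w(x-t) has derivative P(t) w'(x-t), and [P] is O(q^d). *)
Lemma osc_small_scales g0 g1 g2 t1 c d w w' M M' x p q : strong_phase g0 g1 g2 t1 c d ->
  (forall x, is_derive w x (w' x)) -> (forall x, Rabs (w x) <= M) -> (forall x, Rabs (w' x) <= M') ->
  0 < p -> p <= q -> q <= t1 ->
  Rabs (RInt (osc_integrand g0 w x) p q) <= (2 + 4 / d) * / c * (M + M') * Rpower q d.
Proof.
intros Hph Hw HM HM' Hp Hpq Hq.
assert (Ht1 := sp_t1 _ _ _ _ _ _ Hph). assert (Hc := sp_c _ _ _ _ _ _ Hph). assert (Hd := sp_d _ _ _ _ _ _ Hph).
set (k := fun t => cos (g0 t) * / t).
assert (Hk : forall t, 0 < t < 1 -> continuous k t).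
{ intros t Ht. eapply is_derive_continuous_R. apply (kernel_derive Hph t Ht). }
assert (Hosc : forall t, 0 < t < 1 -> continuous (osc_integrand g0 w x) t).
{ intros t Ht. apply (continuous_mult k (fun t => w (x - t))); [auto|].
  apply (continuous_comp (fun t => x - t) w).
  - apply (continuous_minus (fun _ => x) (fun t => t)); [apply continuous_const|apply continuous_id].
  - eapply is_derive_continuous_R; apply Hw. }
set (P := fun t => RInt k p t). set (F := fun t => RInt (osc_integrand g0 w x) p t).
set (Kq := (2 + 4 / d) * / c * Rpower q d).
assert (HP : forall t, p <= t <= q -> Rabs (P t) <= Kq).
{ intros t Ht. eapply Rle_trans; [apply (osc_kernel_bound g0 g1 g2 t1 c d p t); auto; lra|].
  apply Rmult_le_compat_l.
  - apply Rmult_le_pos; [|left; apply Rinv_0_lt_compat; auto].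
    assert (0 < 4 / d) by (apply Rdiv_lt_0_compat; lra). lra.
  - apply Rle_Rpower_l; lra. }
assert (HKq : 0 <= Kq) by (eapply Rle_trans; [apply Rabs_pos|apply (HP p); lra]).
assert (HM0 : 0 <= M') by (eapply Rle_trans; [apply Rabs_pos|apply (HM' 0)]).
assert (HH : Rabs ((F q - P q * w (x - q)) - (F p - P p * w (x - p))) <= Kq * M' * Rabs (q - p)).
{ apply (lipschitz_of_derive (fun t => F t - P t * w (x - t)) (fun t => P t * w' (x - t)) p q); try lra.
  - intros t Ht.
    assert (HdF : is_derive F t (osc_integrand g0 w x t)) by (apply (is_derive_RInt_on _ 0 1); auto; lra).
    assert (HdP : is_derive P t (k t)) by (apply (is_derive_RInt_on _ 0 1); auto; lra).
    assert (Hdw : is_derive (fun t => w (x - t)) t (- w' (x - t))).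
    { replace (- w' (x - t)) with (-1 * w' (x - t)) by ring.
      apply (is_derive_comp w (fun t => x - t)); auto. auto_derive; auto. }
    replace (P t * w' (x - t)) with (osc_integrand g0 w x t - (k t * w (x - t) + P t * - w' (x - t)))
      by (unfold osc_integrand, k, Rdiv; ring).
    apply (is_derive_minus F (fun t => P t * w (x - t))); auto.
    apply (is_derive_mult P (fun t => w (x - t))); auto. intros; apply Rmult_comm.
  - intros t Ht. rewrite Rabs_mult. apply Rmult_le_compat; auto using Rabs_pos. }
assert (F p = 0) by (unfold F; rewrite RInt_point; reflexivity).
assert (P p = 0) by (unfold P; rewrite RInt_point; reflexivity).
rewrite H, H0, Rmult_0_l, !Rminus_0_r, (Rabs_pos_eq (q - p)) in HH by lra.
assert (HPq := HP q ltac:(lra)). assert (HMq := HM (x - q)).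
assert (Hprod : Rabs (P q * w (x - q)) <= Kq * M) by (rewrite Rabs_mult; apply Rmult_le_compat; auto using Rabs_pos).
fold (F q). replace (F q) with ((F q - P q * w (x - q)) + P q * w (x - q)) by ring.
eapply Rle_trans; [apply Rabs_triang|].
assert (Kq * M' * (q - p) <= Kq * M' * 1) by (apply Rmult_le_compat_l; [nra|lra]).
replace ((2 + 4 / d) * / c * (M + M') * Rpower q d) with (Kq * (M + M')) by (unfold Kq; ring).
lra.
Qed.

(** At the endpoint 1 only continuity within (0,1] is given; replacing g0(t) by g0(min(t,1))
    continues the integrand past it. *)
Lemma ex_RInt_osc_to_one g0 w x e :
  (forall t, in_0_1 t -> cont_within in_0_1 g0 t) -> (forall x, continuous w x) -> 0 < e <= 1 ->
  ex_RInt (osc_integrand g0 w x) e 1.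
Proof.
intros Hg Hw He.
apply (ex_RInt_ext (osc_integrand (fun t => g0 (Rmin t 1)) w x)).
- rewrite Rmin_left, Rmax_right by lra. intros t Ht. unfold osc_integrand. rewrite (Rmin_left t) by lra. auto.
- apply (ex_RInt_continuous_on _ 0 2); try lra. intros t Ht.
  apply (continuous_mult (fun t => cos (g0 (Rmin t 1)) * / t) (fun t => w (x - t))).
  + apply (continuous_mult (fun t => cos (g0 (Rmin t 1))) (fun t => / t)).
    * apply continuous_cos_comp. apply continuity_pt_filterlim. intros eta Heta.
      assert (Hm : in_0_1 (Rmin t 1)) by (unfold in_0_1, Rmin; destruct (Rle_dec t 1); lra).
      destruct (Hg _ Hm eta Heta) as [del [Hdel Hcont]].
      exists (Rmin del t). split; [apply Rmin_pos; lra|]. intros s [_ Hs].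
      unfold dist in *; simpl in *. unfold R_dist in *.
      assert (Rmin del t <= del) by apply Rmin_l. assert (Rmin del t <= t) by apply Rmin_r.
      assert (Hst : Rabs (s - t) < del) by lra. assert (Hst' : Rabs (s - t) < t) by lra.
      apply Rabs_def2 in Hst'.
      apply Hcont.
      -- unfold in_0_1, Rmin; destruct (Rle_dec s 1); lra.
      -- eapply Rle_lt_trans; [|apply Hst]. unfold Rmin.
         destruct (Rle_dec s 1), (Rle_dec t 1); unfold Rabs; repeat destruct (Rcase_abs _); lra.
    * eapply is_derive_continuous_R. apply (is_derive_inv (fun t => t)); [apply (is_derive_id t)|]. lra.
  + apply (continuous_comp (fun t => x - t) w); auto.
    apply (continuous_minus (fun _ => x) (fun t => t)); [apply continuous_const|apply continuous_id].
Qed.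

(** Pays, uniformly in x, for stopping at b < 1 in the L^2 argument. *)
Lemma osc_tail_bound g0 w M x b : (forall x, Rabs (w x) <= M) -> / 2 <= b <= 1 ->
  ex_RInt (osc_integrand g0 w x) b 1 ->
  Rabs (RInt (osc_integrand g0 w x) b 1) <= (1 - b) * (2 * M).
Proof.
intros HM Hb Hex. apply abs_RInt_le_const; auto; [lra|].
intros t Ht. unfold osc_integrand, Rdiv. rewrite !Rabs_mult.
assert (Hi : 0 < / t <= 2).
{ split; [apply Rinv_0_lt_compat; lra|]. rewrite <- (Rinv_inv 2). apply Rinv_le_contravar; lra. }
rewrite (Rabs_pos_eq (/ t)) by lra.
assert (Rabs (cos (g0 t)) <= 1) by (apply Rabs_le, COS_bound).
assert (0 <= Rabs (cos (g0 t))) by apply Rabs_pos.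
apply Rmult_le_compat; auto using Rabs_pos; nra.
Qed.

(** [e0] comes before x: the cover is built for one truncation, which must be close to the limit at
    all points. *)
Lemma osc_limit g0 g1 g2 t1 c d w w' M M' : strong_phase g0 g1 g2 t1 c d ->
  (forall t, in_0_1 t -> cont_within in_0_1 g0 t) ->
  (forall x, is_derive w x (w' x)) -> (forall x, Rabs (w x) <= M) -> (forall x, Rabs (w' x) <= M') ->
  forall eta, 0 < eta -> exists e0, 0 < e0 < / 2 /\ forall x, exists l,
    (forall z, 0 < z -> exists del, 0 < del <= 1 /\
       forall e, 0 < e < del -> Rabs (RInt (osc_integrand g0 w x) e 1 - l) < z) /\
    (forall e, 0 < e <= e0 -> Rabs (RInt (osc_integrand g0 w x) e 1 - l) <= eta).
Proof.
intros Hph Hg Hw HM HM' eta Heta.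
assert (Ht1 := sp_t1 _ _ _ _ _ _ Hph). assert (Hc := sp_c _ _ _ _ _ _ Hph). assert (Hd := sp_d _ _ _ _ _ _ Hph).
set (K := (2 + 4 / d) * / c * (M + M')).
assert (HK : 0 <= K).
{ assert (0 <= M) by (eapply Rle_trans; [apply Rabs_pos|apply (HM 0)]).
  assert (0 <= M') by (eapply Rle_trans; [apply Rabs_pos|apply (HM' 0)]).
  assert (0 < 4 / d) by (apply Rdiv_lt_0_compat; lra).
  unfold K. apply Rmult_le_pos; [|lra]. apply Rmult_le_pos; [lra|]. left; apply Rinv_0_lt_compat; auto. }
assert (Hwc : forall x, continuous w x) by (intros x; eapply is_derive_continuous_R; apply Hw).
destruct (Rpower_small K d eta HK Hd Heta) as [e1 [He1 Hsm]].
set (e0 := Rmin e1 (Rmin t1 (/ 4))).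
assert (He0 : 0 < e0) by (apply Rmin_pos; [auto|apply Rmin_pos; lra]).
assert (He01 : e0 <= e1) by apply Rmin_l.
assert (He0t : e0 <= t1) by (eapply Rle_trans; [apply Rmin_r|apply Rmin_l]).
assert (He0h : e0 <= / 4) by (eapply Rle_trans; [apply Rmin_r|apply Rmin_r]).
exists e0. split; [lra|]. intros x.
destruct (limit_at_zero (fun e => RInt (osc_integrand g0 w x) e 1) K d t1 HK Hd ltac:(lra)) as [l Hl].
{ intros p q Hp Hpq Hq.
  rewrite <- (RInt_Chasles (osc_integrand g0 w x) p q 1).
  - change plus with Rplus.
    unfold Rminus. rewrite Rplus_assoc, Rplus_opp_r, Rplus_0_r.
    apply (osc_small_scales g0 g1 g2 t1 c d w w' M M' x p q); auto.
  - apply (ex_RInt_Chasles_1 _ p q 1); [lra|]. apply ex_RInt_osc_to_one; auto; lra.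
  - apply ex_RInt_osc_to_one; auto; lra. }
exists l. split.
- intros z Hz. destruct (Rpower_small K d (z / 2) HK Hd ltac:(lra)) as [e2 [He2 Hsm2]].
  exists (Rmin e2 t1). split.
  + split; [apply Rmin_pos; lra|]. assert (Rmin e2 t1 <= t1) by apply Rmin_r. lra.
  + intros e He. assert (Rmin e2 t1 <= t1) by apply Rmin_r. assert (Rmin e2 t1 <= e2) by apply Rmin_l.
    eapply Rle_lt_trans; [apply Hl; lra|]. eapply Rle_lt_trans; [apply Hsm2; lra|]. lra.
- intros e He. eapply Rle_trans; [apply Hl; lra|]. apply Hsm; lra.
Qed.

Lemma smooth_compact_bounds w K : smooth w -> (forall x, K < Rabs x -> w x = 0) ->
  exists w' M M', (forall x, is_derive w x (w' x)) /\ (forall x, Rabs (w x) <= M) /\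
    (forall x, Rabs (w' x) <= M').
Proof.
intros [D [HD0 HD]] Hsupp. exists (D 1%nat).
assert (Hder : forall n x, is_derive (D n) x (D (S n) x)) by (intros; apply is_derive_Reals, HD).
set (K0 := Rmax K 0). assert (HK1 : K <= K0) by apply Rmax_l. assert (HK2 : 0 <= K0) by apply Rmax_r.
assert (Hbound : forall n, (forall x, K0 < Rabs x -> D n x = 0) -> exists M, forall x, Rabs (D n x) <= M).
{ intros n H0. destruct (continuity_ab_maj (fun x => Rabs (D n x)) (- K0) K0) as [m [Hm _]]; [lra| |].
  - intros x _. apply continuity_pt_filterlim. apply (continuous_comp (D n) Rabs).
    + eapply is_derive_continuous_R; apply Hder.
    + apply continuous_Rabs.
  - exists (Rabs (D n m)). intros x. destruct (Rle_lt_dec (Rabs x) K0) as [Hx|Hx].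
    + apply Hm. apply Rabs_le_between; auto.
    + rewrite H0, Rabs_R0 by auto. apply Rabs_pos. }
assert (H0 : forall x, K0 < Rabs x -> D 0%nat x = 0) by (intros; rewrite HD0; apply Hsupp; lra).
assert (H1 : forall x, K0 < Rabs x -> D 1%nat x = 0).
{ intros x Hx. rewrite <- (is_derive_unique _ _ _ (Hder 0%nat x)). apply is_derive_unique.
  apply (is_derive_ext_loc (fun _ => 0)); [|apply (is_derive_const 0)].
  exists (mkposreal (Rabs x - K0) ltac:(lra)). intros y Hy. symmetry. apply H0.
  change (Rabs (y - x) < Rabs x - K0) in Hy.
  assert (H := Rabs_triang_inv x y). rewrite Rabs_minus_sym in Hy. lra. }
destruct (Hbound 0%nat H0) as [M HM]. destruct (Hbound 1%nat H1) as [M' HM'].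
exists M, M'. rewrite HD0 in HM. split; [|auto]. intros x. rewrite <- HD0. apply Hder.
Qed.

Lemma derive_lipschitz_bounded w w' M M' : (forall x, is_derive w x (w' x)) ->
  (forall x, Rabs (w x) <= M) -> (forall x, Rabs (w' x) <= M') -> lipschitz_bounded w M' M.
Proof.
intros Hw HM HM'. split; auto. intros x y.
apply (lipschitz_of_derive w w' (Rmin x y) (Rmax x y)); auto.
- split; [apply Rmin_l|apply Rmax_l].
- split; [apply Rmin_r|apply Rmax_r].
Qed.

Lemma total_nonneg E : intervals E -> 0 <= total E.
Proof. induction 1; simpl; lra. Qed.

Lemma sum_nth_le_total E : intervals E ->
  forall N, sumr (fun n => snd (nth n E (0, 0)) - fst (nth n E (0, 0))) N <= total E.
Proof.
induction 1 as [|J E HJ HE IH]; intros N.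
- rewrite sumr_zero; [simpl; lra|]. intros [|n] _; simpl; ring.
- destruct N as [|N].
  + apply total_nonneg. constructor; auto.
  + change (S N) with (1 + N)%nat. rewrite sumr_app. simpl. specialize (IH N). lra.
Qed.

Lemma sum_f_R0_sumr f N : sum_f_R0 f N = sumr f (S N).
Proof. induction N; simpl in *; [ring|]. rewrite IHN; auto. Qed.

Lemma outer_measure_le_of_covers (P : R -> Prop) m :
  (forall eta, 0 < eta -> exists E, intervals E /\ total E <= m + eta /\ forall x, P x -> covered E x) ->
  outer_measure_le P m.
Proof.
intros H eta Heta. destruct (H eta Heta) as (E & HE & HT & HP).
(* Past the end of the list, [nth] returns the empty interval (0,0). *)
exists (fun n => fst (nth n E (0, 0))), (fun n => snd (nth n E (0, 0))). split; [|split].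
- intros n. destruct (Nat.lt_ge_cases n (length E)) as [Hn|Hn].
  + apply (proj1 (Forall_forall _ _) HE). apply nth_In; auto.
  + rewrite nth_overflow by auto. simpl; lra.
- intros x Hx. apply HP in Hx. apply Exists_exists in Hx. destruct Hx as [J [HJ Hx]].
  destruct (In_nth E J (0, 0) HJ) as [n [_ Hn]]. exists n. rewrite Hn. auto.
- intros N. rewrite sum_f_R0_sumr. eapply Rle_trans; [apply sum_nth_le_total; auto|auto].
Qed.

Lemma norm_component_le (w q : R -> R) K K0 nf :
  Rmax K 0 <= K0 -> (forall x, continuous w x) ->
  (forall x, K < Rabs x -> w x = 0 /\ q x = 0) -> (forall x, Rabs (w x) <= q x) ->
  is_RInt q (- K) K nf -> RInt (fun y => Rabs (w y)) (- K0) K0 <= nf.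
Proof.
intros HK Hw Hsupp Hle Hq.
assert (K <= Rmax K 0) by apply Rmax_l. assert (0 <= Rmax K 0) by apply Rmax_r.
destruct (Rle_lt_dec 0 K) as [HK0|HK0].
- assert (HI : is_RInt (fun y => Rabs (w y)) (- K) K (RInt (fun y => Rabs (w y)) (- K) K)).
  { apply (RInt_correct (fun y => Rabs (w y))). apply (ex_RInt_continuous (fun y => Rabs (w y))).
    intros z _. apply (continuous_comp w Rabs); [auto|apply continuous_Rabs]. }
  assert (HI0 : is_RInt (fun y => Rabs (w y)) (- K0) K0 (RInt (fun y => Rabs (w y)) (- K) K)).
  { apply (is_RInt_supported _ (fun y => Rabs (w y)) (- K0) (- K) K K0); auto; try lra.
    intros y Hy. destruct (Hsupp y) as [-> _]; [|apply Rabs_R0].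
    unfold Rabs; destruct (Rcase_abs y); lra. }
  rewrite (is_RInt_unique _ _ _ _ HI0).
  apply (is_RInt_le (fun y => Rabs (w y)) q (- K) K); auto. lra.
(* For negative K the support condition holds at every point, so w and q vanish identically and [nf]
   is 0. *)
- assert (HK' : forall x, K < Rabs x) by (intros x; assert (Hx := Rabs_pos x); lra).
  rewrite (is_RInt_unique _ _ _ _ (is_RInt_vanishing (fun y => Rabs (w y)) (- K0) K0
    ltac:(intros y _; destruct (Hsupp y (HK' y)) as [-> _]; apply Rabs_R0))).
  assert (Hq0 : is_RInt q (- K) K 0) by (apply is_RInt_vanishing; intros y _; apply Hsupp; auto).
  apply Req_le. rewrite <- (is_RInt_unique _ _ _ _ Hq), <- (is_RInt_unique _ _ _ _ Hq0). auto.
Qed.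

Lemma riemann_int_is_intro f a b I : is_RInt f a b I -> riemann_int_is f a b I.
Proof.
intros H. assert (Hex : ex_RInt f a b) by (exists I; auto).
exists (ex_RInt_Reals_0 f a b Hex). rewrite <- RInt_Reals. apply is_RInt_unique; auto.
Qed.

Lemma riemann_int_is_elim f a b I : riemann_int_is f a b I -> is_RInt f a b I.
Proof.
intros [pr H]. rewrite <- H, <- RInt_Reals. apply (RInt_correct f). apply ex_RInt_Reals_1; auto.
Qed.

Lemma sqrt_sum_sqr_le a b : sqrt (a ^ 2 + b ^ 2) <= Rabs a + Rabs b.
Proof.
assert (Ha := Rabs_pos a). assert (Hb := Rabs_pos b).
rewrite <- (sqrt_Rsqr (Rabs a + Rabs b)) by lra. apply sqrt_le_1_alt.
unfold Rsqr. rewrite <- (pow2_abs a), <- (pow2_abs b). nra.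
Qed.

Lemma Rabs_le_sqrt_sum_sqr a b : Rabs a <= sqrt (a ^ 2 + b ^ 2).
Proof.
rewrite <- sqrt_Rsqr_abs. apply sqrt_le_1_alt. unfold Rsqr. assert (0 <= b ^ 2) by apply pow2_ge_0. nra.
Qed.

Lemma cont_within_quarter D g0 t : cont_within D g0 t -> cont_within D (quarter g0) t.
Proof.
intros H z Hz. destruct (H z Hz) as [del [Hdel Hc]]. exists del. split; auto.
intros y Hy Hyt. unfold quarter. replace (g0 y - PI / 2 - (g0 t - PI / 2)) with (g0 y - g0 t) by ring. auto.
Qed.

(** Off the cover, the integral over (ep, b), the tail over (b, 1) and the distance from the
    truncation to the limit are each at most al, whence 3 al. *)
Lemma weak_type_component g0 g1 g2 t1 c d : strong_phase g0 g1 g2 t1 c d ->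
  (forall t, in_0_1 t -> cont_within in_0_1 g0 t) ->
  exists B, 0 < B /\ forall w K0 al eta, smooth w -> 0 <= K0 ->
  (forall x, K0 <= Rabs x -> w x = 0) -> 0 < al -> 0 < eta ->
  exists E, intervals E /\ total E <= B / al * RInt (fun y => Rabs (w y)) (- K0) K0 + eta /\
  forall x, exists lc ls,
    (forall z, 0 < z -> exists del, 0 < del <= 1 /\ forall e, 0 < e < del ->
       Rabs (RInt (osc_integrand g0 w x) e 1 - lc) < z /\
       Rabs (RInt (osc_integrand (quarter g0) w x) e 1 - ls) < z) /\
    (~ covered E x -> Rabs lc <= 3 * al /\ Rabs ls <= 3 * al).
Proof.
intros Hph Hg. destruct (weak_type_truncated _ _ _ _ _ _ Hph) as [B [HB Hweak]].
exists B. split; auto. intros w K0 al eta Hsm HK0 Hsupp Hal Heta.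
destruct (smooth_compact_bounds w K0 Hsm) as (w' & M & M' & Hw & HM & HM').
{ intros; apply Hsupp; lra. }
assert (Hlb := derive_lipschitz_bounded w w' M M' Hw HM HM').
assert (Hwc : forall x, continuous w x) by (intros; eapply is_derive_continuous_R; apply Hw).
assert (Hgq : forall t, in_0_1 t -> cont_within in_0_1 (quarter g0) t) by (intros; apply cont_within_quarter; auto).
assert (Hphq := strong_phase_quarter _ _ _ _ _ _ Hph).
destruct (osc_limit g0 g1 g2 t1 c d w w' M M' Hph Hg Hw HM HM' al Hal) as [ec [Hec Hlc]].
destruct (osc_limit _ g1 g2 t1 c d w w' M M' Hphq Hgq Hw HM HM' al Hal) as [es [Hes Hls]].
set (ep := Rmin ec es).
assert (Hep : 0 < ep) by (apply Rmin_pos; lra).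
assert (Hepc : ep <= ec) by apply Rmin_l. assert (Heps : ep <= es) by apply Rmin_r.
assert (HM0 : 0 <= M) by (eapply Rle_trans; [apply Rabs_pos|apply (HM 0)]).
(* Makes the tail bound 2 M (1 - b) at most al; M may be 0, hence the + 1. *)
set (b := 1 - Rmin (/ 4) (al / (2 * M + 1))).
assert (Hb0 : 0 < Rmin (/ 4) (al / (2 * M + 1))) by (apply Rmin_pos; [lra|apply Rdiv_lt_0_compat; lra]).
assert (Hb1 : Rmin (/ 4) (al / (2 * M + 1)) <= / 4) by apply Rmin_l.
assert (Hb2 : (1 - b) * (2 * M) <= al).
{ assert (H : 1 - b <= al / (2 * M + 1)) by (unfold b; ring_simplify; apply Rmin_r).
  apply (Rmult_le_compat_r (2 * M + 1)) in H; [|lra].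
  replace (al / (2 * M + 1) * (2 * M + 1)) with al in H by (field; lra).
  assert (0 < 1 - b) by (unfold b; lra). lra. }
assert (Hb : / 2 < b < 1) by (unfold b; lra).
destruct (Hweak w M' M K0 ep b al eta Hlb HK0 Hsupp Hep ltac:(lra) ltac:(lra) Hal Heta) as (E & HE & HT & Hcov).
exists E. split; [auto|split; [auto|]]. intros x.
destruct (Hlc x) as [lc [Hlc1 Hlc2]]. destruct (Hls x) as [ls [Hls1 Hls2]].
exists lc, ls. split.
- intros z Hz. destruct (Hlc1 z Hz) as [d1 [Hd1 H1]]. destruct (Hls1 z Hz) as [d2 [Hd2 H2]].
  assert (Rmin d1 d2 <= d1) by apply Rmin_l. assert (Rmin d1 d2 <= d2) by apply Rmin_r.
  exists (Rmin d1 d2). split; [split; [apply Rmin_pos; lra|lra]|].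
  intros e He. split; [apply H1|apply H2]; lra.
- intros Hno.
  assert (Hgen : forall g l, (forall t, in_0_1 t -> cont_within in_0_1 g t) ->
    Rabs (RInt (osc_integrand g w x) ep 1 - l) <= al ->
    Rabs (RInt (osc_integrand g w x) ep b) <= al -> Rabs l <= 3 * al).
  { intros g l Hcg H1 H2.
    assert (Hex : forall e, 0 < e <= 1 -> ex_RInt (osc_integrand g w x) e 1) by (intros; apply ex_RInt_osc_to_one; auto).
    assert (H3 := osc_tail_bound g w M x b HM ltac:(lra) (Hex b ltac:(lra))).
    assert (Hex1 : ex_RInt (osc_integrand g w x) ep b) by (apply (ex_RInt_Chasles_1 (osc_integrand g w x) ep b 1); [lra|apply Hex; lra]).
    rewrite <- (RInt_Chasles (osc_integrand g w x) ep b 1) in H1; auto; [|apply Hex; lra].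
    change plus with Rplus in H1.
    apply Rabs_le_between in H1. apply Rabs_le_between in H2. apply Rabs_le_between in H3.
    apply Rabs_le. lra. }
  split.
  + apply (Hgen g0 lc Hg (Hlc2 ep ltac:(lra))). apply Rnot_lt_le. intros H; apply Hno, Hcov; auto.
  + apply (Hgen (quarter g0) ls Hgq (Hls2 ep ltac:(lra))). apply Rnot_lt_le. intros H; apply Hno, Hcov; auto.
Qed.

Lemma T1_limit_intro g0 u v x lcu lsu lcv lsv :
  (forall t, in_0_1 t -> cont_within in_0_1 g0 t) ->
  (forall x, continuous u x) -> (forall x, continuous v x) ->
  (forall z, 0 < z -> exists del, 0 < del <= 1 /\ forall e, 0 < e < del ->
       Rabs (RInt (osc_integrand g0 u x) e 1 - lcu) < z /\
       Rabs (RInt (osc_integrand (quarter g0) u x) e 1 - lsu) < z) ->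
  (forall z, 0 < z -> exists del, 0 < del <= 1 /\ forall e, 0 < e < del ->
       Rabs (RInt (osc_integrand g0 v x) e 1 - lcv) < z /\
       Rabs (RInt (osc_integrand (quarter g0) v x) e 1 - lsv) < z) ->
  T1_limit g0 u v x (lcu - lsv) (lsu + lcv).
Proof.
intros Hg Hu Hv Hlu Hlv eta Heta.
assert (Hgq : forall t, in_0_1 t -> cont_within in_0_1 (quarter g0) t) by (intros; apply cont_within_quarter; auto).
destruct (Hlu (eta / 4) ltac:(lra)) as [d1 [Hd1 H1]]. destruct (Hlv (eta / 4) ltac:(lra)) as [d2 [Hd2 H2]].
assert (Rmin d1 d2 <= d1) by apply Rmin_l. assert (Rmin d1 d2 <= d2) by apply Rmin_r.
exists (Rmin d1 d2). split; [apply Rmin_pos; lra|]. intros e He.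
destruct (H1 e ltac:(lra)) as [H1c H1s]. destruct (H2 e ltac:(lra)) as [H2c H2s].
assert (Hint : forall g w, (forall t, in_0_1 t -> cont_within in_0_1 g t) -> (forall x, continuous w x) ->
  is_RInt (osc_integrand g w x) e 1 (RInt (osc_integrand g w x) e 1)).
{ intros g w Hcg Hcw. apply (RInt_correct (osc_integrand g w x)). apply ex_RInt_osc_to_one; auto. lra. }
set (Icu := RInt (osc_integrand g0 u x) e 1) in *. set (Isu := RInt (osc_integrand (quarter g0) u x) e 1) in *.
set (Icv := RInt (osc_integrand g0 v x) e 1) in *. set (Isv := RInt (osc_integrand (quarter g0) v x) e 1) in *.
exists (Icu - Isv), (Isu + Icv). split; [|split].
- apply riemann_int_is_intro.
  apply (is_RInt_ext (fun t => osc_integrand g0 u x t - osc_integrand (quarter g0) v x t)).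
  + assert (HT : forall t, osc_integrand g0 u x t - osc_integrand (quarter g0) v x t = T1_re g0 u v x t); [|auto].
    intros t. unfold osc_integrand, quarter, T1_re. rewrite cos_quarter_turn. unfold Rdiv; ring.
  + apply (is_RInt_minus (osc_integrand g0 u x) (osc_integrand (quarter g0) v x)); apply Hint; auto.
- apply riemann_int_is_intro.
  apply (is_RInt_ext (fun t => osc_integrand (quarter g0) u x t + osc_integrand g0 v x t)).
  + assert (HT : forall t, osc_integrand (quarter g0) u x t + osc_integrand g0 v x t = T1_im g0 u v x t); [|auto].
    intros t. unfold osc_integrand, quarter, T1_im. rewrite cos_quarter_turn. unfold Rdiv; ring.
  + apply (is_RInt_plus (osc_integrand (quarter g0) u x) (osc_integrand g0 v x)); apply Hint; auto.
- eapply Rle_lt_trans; [apply sqrt_sum_sqr_le|].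
  apply Rabs_def2 in H1c, H1s, H2c, H2s.
  assert (Rabs (Icu - Isv - (lcu - lsv)) < eta / 2) by (apply Rabs_def1; lra).
  assert (Rabs (Isu + Icv - (lsu + lcv)) < eta / 2) by (apply Rabs_def1; lra).
  lra.
Qed.

(* g0..g3 = gamma, gamma', gamma'', gamma'''; p0..p2 = psi, psi', psi''. *)
Theorem mainTheorem1
  (g0 g1 g2 g3 p0 p1 p2 : R -> R) (t0 s0 C eps A0 lam : R)
  (* gamma in C^3((0,1]) *)
  (Hg0 : forall t, 0 < t < 1 -> derivable_pt_lim g0 t (g1 t))
  (Hg1 : forall t, 0 < t < 1 -> derivable_pt_lim g1 t (g2 t))
  (Hg2 : forall t, 0 < t < 1 -> derivable_pt_lim g2 t (g3 t))
  (Hgc : forall t, in_0_1 t ->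
     cont_within in_0_1 g0 t /\ cont_within in_0_1 g1 t /\
     cont_within in_0_1 g2 t /\ cont_within in_0_1 g3 t)
  (* lim_{t->0+} |gamma t| = infinity *)
  (Hginf : forall M, exists d, 0 < d /\ forall t, 0 < t < d -> M < Rabs (g0 t))
  (* psi in C^2([0,1]) *)
  (Hp0 : forall t, 0 < t < 1 -> derivable_pt_lim p0 t (p1 t))
  (Hp1 : forall t, 0 < t < 1 -> derivable_pt_lim p1 t (p2 t))
  (Hpc : forall t, in_cl_0_1 t ->
     cont_within in_cl_0_1 p0 t /\ cont_within in_cl_0_1 p1 t /\
     cont_within in_cl_0_1 p2 t)
  (Hppos : forall t, in_0_1 t -> 0 < p0 t)
  (Hplim : forall e, 0 < e -> exists d, 0 < d /\
     forall t, 0 < t < d -> Rabs (p0 t) < e)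
  (Ht0 : 0 < t0) (Hs0 : 0 < s0) (HC : 0 < C)
  (* (a.1) *)
  (Ha1g0 : monotone_on in_0_1 g0)
  (Ha1p0 : monotone_on in_cl_0_1 p0)
  (Ha1g1 : monotone_on in_0_1 g1)
  (Ha1g2 : monotone_on in_0_1 g2)
  (Ha1p1 : monotone_on in_cl_0_1 p1)
  (Ha1pos : forall t, in_0_1 t -> 0 < g1 t)
  (Ha1dec : forall t u, in_0_1 t -> in_0_1 u -> t < u -> g1 u < g1 t)
  (* (a.2) *)
  (Ha2 : forall t, 0 < t < t0 -> t <= 1 ->
     Rabs (p1 t / p0 t) <= / 2 * Rabs (g3 t / g2 t))
  (* (a.3): |gamma''(gamma'^{-1}(2s))| <= C |gamma''(gamma'^{-1}(s))| *)
  (Ha3 : forall s, s0 < s -> forall t1 t2, in_0_1 t1 -> in_0_1 t2 ->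
     g1 t1 = s -> g1 t2 = 2 * s -> Rabs (g2 t2) <= C * Rabs (g2 t1))
  (* (a.4) *)
  (Heps : 0 < eps) (HA0 : 1 + eps < A0)
  (Ha4 : forall t, 0 < t < t0 -> (1 + eps) * t <= 1 ->
     g1 t >= A0 * g1 ((1 + eps) * t))
  (* (a.5) *)
  (Hlam : / 2 < lam < 1)
  (Ha5 : forall t, 0 < t < t0 -> t <= 1 ->
     Rabs (g2 t) <= C * Rpower (g1 t) (2 * lam)) :
  exists A : R, forall (u v : R -> R) (K : R),
    smooth u -> smooth v ->
    (forall x, K < Rabs x -> u x = 0 /\ v x = 0) ->
    forall normf : R,
      riemann_int_is (fun x => sqrt (u x ^ 2 + v x ^ 2)) (- K) K normf ->
    forall alpha : R, 0 < alpha ->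
      outer_measure_le
        (fun x => forall Lr Li, T1_limit g0 u v x Lr Li ->
                    alpha < sqrt (Lr ^ 2 + Li ^ 2))
        (A / alpha * normf).
Proof.
destruct (strong_phase_intro g0 g1 g2 t0 eps A0 Hg0 Hg1 Ht0 Ha1g2 Ha1pos Ha1dec Heps HA0 Ha4)
  as (t1 & c & d & Hph).
assert (Hg : forall t, in_0_1 t -> cont_within in_0_1 g0 t) by (intros t Ht; apply Hgc; auto).
destruct (weak_type_component _ _ _ _ _ _ Hph Hg) as [B [HB Hcomp]].
(* With al = alpha/12 each of the four limits is at most 3 al = alpha/4, and the covers for u and v
   each cost B/al = 12 B/alpha times the norm. *)
exists (24 * B). intros u v K Hu Hv Hsupp normf Hnorm alpha Halpha.
apply riemann_int_is_elim in Hnorm.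
set (K0 := Rmax K 0 + 1). set (al := alpha / 12).
assert (HK1 : K <= Rmax K 0) by apply Rmax_l. assert (HK2 : 0 <= Rmax K 0) by apply Rmax_r.
assert (Hal : 0 < al) by (unfold al; lra).
assert (Hsu : forall x, K0 <= Rabs x -> u x = 0) by (intros x Hx; apply Hsupp; unfold K0 in Hx; lra).
assert (Hsv : forall x, K0 <= Rabs x -> v x = 0) by (intros x Hx; apply Hsupp; unfold K0 in Hx; lra).
assert (Hcont : forall w, smooth w -> forall x, continuous w x).
{ intros w [D [HD0 HD]] x. rewrite <- HD0. apply (is_derive_continuous_R _ _ (D 1%nat x)).
  apply is_derive_Reals, HD. }
assert (Hzero : forall x, K < Rabs x -> sqrt (u x ^ 2 + v x ^ 2) = 0).
{ intros x Hx. destruct (Hsupp x Hx) as [-> ->]. replace (0 ^ 2 + 0 ^ 2) with 0 by ring. apply sqrt_0. }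
assert (Hnu : RInt (fun y => Rabs (u y)) (- K0) K0 <= normf).
{ apply (norm_component_le u (fun x => sqrt (u x ^ 2 + v x ^ 2)) K K0); auto.
  - unfold K0; lra.
  - intros x Hx. split; [apply Hsupp|apply Hzero]; auto.
  - intros x. apply Rabs_le_sqrt_sum_sqr. }
assert (Hnv : RInt (fun y => Rabs (v y)) (- K0) K0 <= normf).
{ apply (norm_component_le v (fun x => sqrt (u x ^ 2 + v x ^ 2)) K K0); auto.
  - unfold K0; lra.
  - intros x Hx. split; [apply Hsupp|apply Hzero]; auto.
  - intros x. rewrite Rplus_comm. apply Rabs_le_sqrt_sum_sqr. }
apply outer_measure_le_of_covers. intros eta Heta.
destruct (Hcomp u K0 al (eta / 2) Hu ltac:(unfold K0; lra) Hsu Hal ltac:(lra)) as (Eu & HEu & HTu & Hlu).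
destruct (Hcomp v K0 al (eta / 2) Hv ltac:(unfold K0; lra) Hsv Hal ltac:(lra)) as (Ev & HEv & HTv & Hlv).
exists (Eu ++ Ev). split; [apply Forall_app; auto|split].
- rewrite total_app.
  assert (HBal : 0 < B / al) by (apply Rdiv_lt_0_compat; auto).
  apply (Rmult_le_compat_l (B / al)) in Hnu; [|lra]. apply (Rmult_le_compat_l (B / al)) in Hnv; [|lra].
  replace (24 * B / alpha * normf) with (B / al * normf + B / al * normf) by (unfold al; field; lra).
  lra.
(* A point without any limit would belong to the set vacuously, so off the cover a limit must be
   exhibited; [T1_limit_intro] does so. *)
- intros x Hx. apply covered_app. apply NNPP. intros Hno.
  destruct (Hlu x) as (lcu & lsu & Hlimu & Hbu). destruct (Hlv x) as (lcv & lsv & Hlimv & Hbv).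
  destruct Hbu as [Hbu1 Hbu2]; [tauto|]. destruct Hbv as [Hbv1 Hbv2]; [tauto|].
  assert (HL := Hx _ _ (T1_limit_intro g0 u v x _ _ _ _ Hg (Hcont u Hu) (Hcont v Hv) Hlimu Hlimv)).
  assert (Hs := sqrt_sum_sqr_le (lcu - lsv) (lsu + lcv)).
  assert (H1 := Rabs_triang lcu (- lsv)). rewrite Rabs_Ropp in H1.
  assert (H2 := Rabs_triang lsu lcv).
  unfold Rminus in Hs, HL. unfold al in *. lra.
Qed.
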